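(* Let $d\ge2$ and $a,b\in(0,\infty)$, and let $X=(X_n)_{n\in\mathbb{Z}_+}$ be an elliptic random walk on $\mathbb{R}^d$ with parameters $a,b$. Then $X$ is transient if $a^2<(d-1)b^2$, and $X$ is null-recurrent if $a^2\ge(d-1)b^2$.
   Context: $\mathbb{Z}_+=\{0,1,2,\ldots\}$, $\|\cdot\|$ is the Euclidean norm, $\mathbb{S}^{d-1}$ is the unit sphere of $\mathbb{R}^d$, $\mathbf{e}_1,\ldots,\mathbf{e}_d$ is the standard basis, $\hat{\mathbf{x}}=\mathbf{x}/\|\mathbf{x}\|$ for $\mathbf{x}\neq\mathbf{0}$, and $\hat{\mathbf{0}}=\mathbf{e}_1$. Elliptic random walk: for each $\mathbf{u}\in\mathbb{S}^{d-1}$ let $Q_{\mathbf{u}}$ be an orthogonal $d\times d$ matrix with $Q_{\mathbf{u}}\mathbf{e}_1=\mathbf{u}$, and let $D=\sqrt d\,\operatorname{diag}(a,b,\ldots,b)$. Let $\boldsymbol{\zeta}_0,\boldsymbol{\zeta}_1,\ldots$ be independent random vectors, each uniformly distributed on $\mathbb{S}^{d-1}$. The elliptic random walk is the time-homogeneous Markov process $X$ on $\mathbb{R}^d$ started from a fixed (non-random) point $X_0\in\mathbb{R}^d$ whose increments are given, on $\{X_n=\mathbf{x}\}$, by $X_{n+1}-X_n=Q_{\hat{\mathbf{x}}}D\boldsymbol{\zeta}_n$. (The law of the walk does not depend on the choice of the matrices $Q_{\mathbf{u}}$; equivalently one may take $X_{n+1}-X_n=b\sqrt d\,\boldsymbol{\zeta}_n+(a-b)\sqrt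 d\,\hat{\mathbf{x}}\langle\hat{\mathbf{x}},\boldsymbol{\zeta}_n\rangle$ on $\{X_n=\mathbf{x}\}$.) $X$ is transient if $\lim_{n\to\infty}\|X_n\|=+\infty$ almost surely. $X$ is recurrent if there is a constant $r_0\in[0,\infty)$ such that $\liminf_{n\to\infty}\|X_n\|\le r_0$ almost surely. $X$ is null if for every bounded $A\subset\mathbb{R}^d$, $\lim_{n\to\infty}\frac1n\sum_{k=0}^{n-1}\mathbf{1}\{X_k\in A\}=0$ almost surely and in $L^q$ for any $q\ge1$. $X$ is null-recurrent if it is both recurrent and null. *)

(* Defs.v *)
From HB Require Import structures.
From mathcomp Require Import all_boot all_order all_algebra finmap.
From mathcomp Require Import all_classical all_reals all_analysis.

Set Implicit Arguments.
Unset Strict Implicit.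
Unset Printing Implicit Defensive.

Import Order.TTheory GRing.Theory Num.Theory.
Import numFieldNormedType.Exports.

Local Open Scope classical_set_scope.
Local Open Scope ring_scope.

(* The library norm on matrices is the sup norm, hence this definition. *)
Definition enorm (R : realType) (d : nat) (x : 'cV[R]_d) : R :=
  Num.sqrt (\sum_(i < d) x i 0 ^+ 2).

Definition usphere (R : realType) (d : nat) : set 'cV[R]_d :=
  [set u | enorm u = 1].

(* The first standard basis vector; the coordinate index runs from 0. *)
Definition e1 (R : realType) (d : nat) : 'cV[R]_d :=
  \col_(i < d) (i == 0%N :> nat)%:R.

Definition hat (R : realType) (d : nat) (x : 'cV[R]_d) : 'cV[R]_d :=
  if x == 0 then e1 R d else (enorm x)^-1 *: x.

Definition orthogonal_mx (R : realType) (d : nat) (U : 'M[R]_d) : Prop :=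
  U^T *m U = 1%:M.

(* Matrices (in particular vectors of R^d) with their Borel sigma-algebra. *)
Definition borel_mx (R : realType) (m n : nat) :=
  g_sigma_algebraType (@open 'M[R]_(m, n)).

Section random_vectors.
Context (disp : measure_display) (T : measurableType disp) (R : realType).
Variables (P : probability T R) (d : nat).

Definition random_vector (Y : T -> 'cV[R]_d) : Prop :=
  measurable_fun [set: T] (Y : T -> borel_mx R d 1).

(* The uniform distribution on the sphere is the (unique) probability measure
   carried by the sphere and invariant under the orthogonal group. *)
Definition uniform_on_sphere (Y : T -> 'cV[R]_d) : Prop :=
  [/\ random_vector Y,
      P (Y @^-1` @usphere R d) = 1%E &
      forall (U : 'M[R]_d) (B : set (borel_mx R d 1)),
        orthogonal_mx U -> measurable B ->
        P [set w | B (U *m Y w)] = P [set w | B (Y w)]].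

Definition mutually_independent (Y : nat -> T -> 'cV[R]_d) : Prop :=
  forall (J : {fset nat}) (B : nat -> set (borel_mx R d 1)),
    (forall n, measurable (B n)) ->
    P (\bigcap_(n in [set` J]) [set w | B n (Y n w)]) =
    (\prod_(n <- J) P [set w | B n (Y n w)])%E.

End random_vectors.

(* The matrices Q_u matter only for u on the sphere.  Borel measurability of
   u |-> Q_u is what makes the walk a sequence of random vectors (and a Markov
   process) for an arbitrary choice of the Q_u. *)
Definition rotation_choice (R : realType) (d : nat)
    (Q : 'cV[R]_d -> 'M[R]_d) : Prop :=
  [/\ forall u, usphere u -> orthogonal_mx (Q u),
      forall u, usphere u -> Q u *m e1 R d = u &
      measurable_fun (@usphere R d : set (borel_mx R d 1))
        (Q : borel_mx R d 1 -> borel_mx R d d)].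

(* D = sqrt d * diag (a, b, ..., b) *)
Definition elliptic_mx (R : realType) (d : nat) (a b : R) : 'M[R]_d :=
  Num.sqrt d%:R *: diag_mx (\row_(i < d) if i == 0%N :> nat then a else b).

Definition elliptic_random_walk (disp : measure_display)
    (T : measurableType disp) (R : realType) (P : probability T R) (d : nat)
    (a b : R) (X : nat -> T -> 'cV[R]_d) : Prop :=
  exists (Q : 'cV[R]_d -> 'M[R]_d) (zeta : nat -> T -> 'cV[R]_d)
         (x0 : 'cV[R]_d),
    [/\ rotation_choice Q,
        forall n, uniform_on_sphere P (zeta n),
        mutually_independent P zeta,
        forall w, X 0%N w = x0 &
        forall n w,
          X n.+1 w - X n w = Q (hat (X n w)) *m elliptic_mx d a b *m zeta n w].

Section recurrence.
Context (disp : measure_display) (T : measurableType disp) (R : realType).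
Variables (P : probability T R) (d : nat) (X : nat -> T -> 'cV[R]_d).

Definition transient : Prop :=
  {ae P, forall w, enorm (X n w) @[n --> \oo] --> +oo}.

Definition recurrent : Prop :=
  exists2 r0 : R, 0 <= r0 &
    {ae P, forall w, (limn_einf (fun n => (enorm (X n w))%:E) <= r0%:E)%E}.

Definition occupation (A : set 'cV[R]_d) (n : nat) (w : T) : R :=
  n%:R^-1 * \sum_(0 <= k < n) \1_A (X k w).

Definition null : Prop :=
  forall A : set 'cV[R]_d, (exists M : R, forall x, A x -> enorm x <= M) ->
    {ae P, forall w, occupation A n w @[n --> \oo] --> (0 : R)} /\
    forall q : R, 1 <= q ->
      'N[P]_(q%:E)[EFin \o occupation A n]%E @[n --> \oo] --> 0%E.

Definition null_recurrent : Prop := recurrent /\ null.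

End recurrence.

(* Main.v *)
(** The squared norm [S_n] of the walk is a Markov chain of its own, driven by
the first coordinates [z_n] of the sphere vectors: with [al = sqrt d * a] and
[be = sqrt d * b],
  [S_(n+1) = (sqrt S_n + al * z_n)^2 + be^2 * (1 - z_n^2)],
and symmetry gives [E z_n = 0], [E z_n^2 = 1/d].  Each claim follows from a
one-step drift estimate for a Lyapunov function of [S], so that no martingale
convergence theorem is needed.
- Transience: for [c] large, [E f(S_(n+1)) <= E f(S_n) - eta * E (c + S_n)^-3]
  with [f s = 1 / ln (c + s)], for all values of [S_n].  The negative terms are
  therefore summable, and [S_n] tends to infinity almost surely.
- Recurrence: [sqrt (ln s)] has drift at most [- kap / s^3] for [s >= r], also
  in the critical case.  Freeze the chain when it enters [[0, r]] after time
  [N].  If it never does, the summable drift makes [S_n] tend to infinity,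
  while by Fatou's lemma [liminf sqrt (ln S_n)] is almost surely finite.
- Nullity: [sqrt (c + s)] has drift at least [eta / sqrt (c + s)] and
  [E sqrt (c + S_n) = O(sqrt n)], hence the expected number of visits to a
  bounded set before time [n] is [O(sqrt n)].  Along [n = 2^j] the frequencies
  have summable expectations; monotonicity of the number of visits does the
  rest. *)
Require Import Defs.
From HB Require Import structures.
From mathcomp Require Import all_boot all_order all_algebra finmap.
From mathcomp Require Import fingroup perm.
From mathcomp Require Import all_classical all_reals all_analysis.
From mathcomp Require Import measurable_realfun ring lra.

Set Implicit Arguments.
Unset Strict Implicit.
Unset Printing Implicit Defensive.

Import Order.TTheory GRing.Theory Num.Theory.
Import numFieldNormedType.Exports.

Local Open Scope classical_set_scope.
Local Open Scope ring_scope.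

(** * Drift inequalities *)

Section drift.
Context {R : realType}.
Implicit Types (al be v x y z s p r c L l u g : R).

(** The remainder vanishes at 0 and has derivative [u ^+ 2 / (1 + u)], at most [2 * u ^+ 2] for
    [|u| <= 1/2]; the mean value theorem concludes on either side of 0. *)
Lemma ln1D_taylor2 x : `|x| <= 2^-1 ->
  `|ln (1 + x) - x + x ^+ 2 / 2| <= 2 * `|x| ^+ 3.
Proof.
move=> hx.
pose f u : R := ln (1 + u) - u + u ^+ 2 / 2.
pose df u : R := (1 + u)^-1 - 1 + u.
have derf (u : R) : `|u| <= 2^-1 -> is_derive u (1:R) f (df u).
  rewrite ler_norml => /andP[u1 u2].
  have u0 : 0 < 1 + u by lra.
  have h : is_derive u (1:R) (fun v : R => ln (1 + v)) ((1 + u)^-1 * 1).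
    apply: (@is_derive1_comp R (@ln R) (+%R (1:R)) u (1 + u)^-1 1).
      exact: is_derive1_ln.
    by apply: is_derive_eq; rewrite add0r.
  rewrite /f /df; apply: is_derive_eq.
  rewrite /= /GRing.scale/=; lra.
have f0 : f 0 = 0 by rewrite /f addr0 ln1; lra.
have df_bnd (u : R) : `|u| <= 2^-1 -> `|df u| <= 2 * u ^+ 2.
  rewrite ler_norml => /andP[u1 u2].
  have u0 : 0 < 1 + u by lra.
  have -> : df u = u ^+ 2 / (1 + u) by rewrite /df; field; lra.
  rewrite ger0_norm ?divr_ge0 ?sqr_ge0//; last lra.
  rewrite ler_pdivrMr// -subr_ge0.
  have -> : 2 * u ^+ 2 * (1 + u) - u ^+ 2 = u ^+ 2 * (1 + 2 * u) by ring.
  by rewrite mulr_ge0 ?sqr_ge0//; lra.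
have key (u : R) : `|u| <= `|x| -> `|f x - f 0| = `|df u * x| ->
    `|f x| <= 2 * `|x| ^+ 3.
  move=> ux; rewrite f0 subr0 => ->; rewrite normrM.
  rewrite exprSr mulrA ler_wpM2r//.
  apply: le_trans (df_bnd u (le_trans ux hx)) _.
  by rewrite ler_pM2l// -(real_normK (num_real u)) lerXn2r// ?nnegrE.
change (`|f x| <= 2 * `|x| ^+ 3).
have cf (u : R) : `|u| <= 2^-1 -> {for u, continuous f}.
  move=> hu; apply: differentiable_continuous; apply/derivable1_diffP.
  by have [] := derf _ hu.
have [x0|x0] := leP 0 x.
- have [||c] := @MVT_segment R f df 0 x x0.
  + move=> u; rewrite in_itv/= => /andP[u0 ux]; apply: derf.
    by rewrite (le_trans _ hx)// !ger0_norm// ?ltW// (lt_le_trans u0)// ltW.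
  + apply: continuous_in_subspaceT => u.
    rewrite inE/= in_itv/= => /andP[u0 ux]; apply: cf.
    by rewrite (le_trans _ hx)// !ger0_norm.
  rewrite in_itv/= => /andP[c0 cx] e.
  apply: (key c); first by rewrite !ger0_norm.
  by rewrite e subr0.
- have [||c] := @MVT_segment R f df x 0 (ltW x0).
  + move=> u; rewrite in_itv/= => /andP[u0 ux]; apply: derf.
    by rewrite (le_trans _ hx)// !ltr0_norm//; lra.
  + apply: continuous_in_subspaceT => u.
    rewrite inE/= in_itv/= => /andP[u0 ux]; apply: cf.
    by rewrite (le_trans _ hx)// !ler0_norm//; lra.
  rewrite in_itv/= => /andP[c0 cx] e.
  apply: (key c); first by rewrite !ler0_norm//; lra.
  by rewrite distrC e sub0r mulrN normrN.
Qed.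

(* Below, [r] is the inverse of the radius, [P] and [Q] are the martingale part
   (of order [r]) and the remaining part (of order [r ^ 2]) of the relative
   increment of the squared radius. *)
Lemma sqrD_err (c r P Q : R) : 0 <= r <= 1 -> `|P| <= c * r ->
  0 <= Q <= c * r ^+ 2 -> `|(P + Q) ^+ 2 - P ^+ 2| <= 3 * c ^+ 2 * r ^+ 3.
Proof.
move=> /andP[r0 r1] hP /andP[Q0 hQ].
have -> : (P + Q) ^+ 2 - P ^+ 2 = Q * (Q + 2 * P) by ring.
rewrite normrM (ger0_norm Q0).
have cr0 : 0 <= c * r := le_trans (normr_ge0 P) hP.
have Qcr : Q <= c * r.
  by apply: le_trans hQ _; rewrite expr2 mulrA -[leRHS]mulr1 ler_wpM2l.
have h : `|Q + 2 * P| <= 3 * (c * r).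
  apply: le_trans (ler_normD _ _) _.
  by rewrite (ger0_norm Q0) normrM (@ger0_norm _ 2)//; lra.
have -> : 3 * c ^+ 2 * r ^+ 3 = (c * r ^+ 2) * (3 * (c * r)) by ring.
by rewrite ler_pM.
Qed.

(** Second-order expansion with [(P + Q) ^+ 2] replaced by [P ^+ 2], the difference being of order
    [r ^+ 3]. In [C], the summand [3 * c ^+ 2] pays for this replacement and [3 * c ^+ 3] for the
    cubic remainder. *)
Lemma ln1D_split (c r P Q : R) : 0 <= r <= 1 -> c * r <= 2^-1 ->
  `|P| <= c * r -> 0 <= Q <= c * r ^+ 2 -> `|P + Q| <= c * r ->
  let C := 3 * c ^+ 2 + 3 * c ^+ 3 in let l := ln (1 + (P + Q)) in
  [/\ `|l - (P + Q - P ^+ 2 / 2)| <= C * r ^+ 3,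
      l ^+ 2 <= 4 * c ^+ 2 * r ^+ 2 & P ^+ 2 - C * r ^+ 3 <= l ^+ 2].
Proof.
move=> r01 cr hP hQ hX C l; have /andP[r0 r1] := r01.
have cr0 : 0 <= c * r := le_trans (normr_ge0 P) hP.
set X := P + Q in l hX *.
have X2 : `|X| <= 2^-1 := le_trans hX cr.
have T := ln1D_taylor2 X2.
have E := sqrD_err r01 hP hQ; rewrite -/X in E.
have X3 : `|X| ^+ 3 <= c ^+ 3 * r ^+ 3.
  by rewrite -exprMn lerXn2r// nnegrE.
have XX : X ^+ 2 = `|X| ^+ 2 by rewrite real_normK// num_real.
have n0 := normr_ge0 X.
move/ler_normlP: T => [T1 T2]; move/ler_normlP: E => [E1 E2].
have l_err : `|l - X| <= 3 / 2 * `|X| ^+ 2.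
  have : `|X| ^+ 3 <= `|X| ^+ 2 * 2^-1 by rewrite exprSr ler_wpM2l// sqr_ge0.
  by move=> h; rewrite ler_norml; apply/andP; split; rewrite /l; nra.
have r3 : 0 <= c ^+ 3 * r ^+ 3 by rewrite -exprMn exprn_ge0.
have r2 : 0 <= c ^+ 2 * r ^+ 3.
  by rewrite mulr_ge0 ?sqr_ge0 ?exprn_ge0.
split.
- by rewrite ler_norml /C; apply/andP; split; rewrite /l; lra.
- have hl : `|l| <= 2 * (c * r).
    have : `|l| <= `|l - X| + `|X|.
      by rewrite -{1}(subrK X l) ler_normD.
    nra.
  have -> : 4 * c ^+ 2 * r ^+ 2 = (2 * (c * r)) ^+ 2 by ring.
  by rewrite -[leLHS]real_normK ?num_real// lerXn2r// ?nnegrE//; lra.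
- have h : X ^+ 2 - 3 * `|X| ^+ 3 <= l ^+ 2.
    have -> : l ^+ 2 = X ^+ 2 + 2 * (X * (l - X)) + (l - X) ^+ 2 by ring.
    have : - (X * (l - X)) <= `|X| * (3 / 2 * `|X| ^+ 2).
      apply: le_trans (ler_norm _) _; rewrite normrN normrM.
      by rewrite ler_wpM2l.
    have := sqr_ge0 (l - X).
    have -> : `|X| * (3 / 2 * `|X| ^+ 2) = 3 / 2 * `|X| ^+ 3 by ring.
    lra.
  by rewrite /C; lra.
Qed.

(* If [z] is centered with variance [v] and [`|z| <= 1], then
   [quad_le v phi g] implies [E phi(z) <= g]. *)
Definition quad_le (v : R) (phi : R -> R) (g : R) : Prop :=
  exists A B D : R,
    (forall z, `|z| <= 1 -> phi z <= A * z + B * z ^+ 2 + D) /\ B * v + D <= g.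

(** Expanded in powers of [z]: the linear term is centered, and the rest of the increment stays
    bounded as [s] grows. *)
Definition radial_step (al be s z : R) : R :=
  s + 2 * al * Num.sqrt s * z + be ^+ 2 + (al ^+ 2 - be ^+ 2) * z ^+ 2.

Lemma eq_quad_le v (phi psi : R -> R) (g : R) :
  (forall x, `|x| <= 1 -> phi x = psi x) -> quad_le v phi g -> quad_le v psi g.
Proof.
move=> e [A [B [D [h1 h2]]]]; exists A, B, D; split => // x x1.
by rewrite -e// h1.
Qed.

Lemma quadratic_part_bounds al be z : `|z| <= 1 ->
  0 <= be ^+ 2 + (al ^+ 2 - be ^+ 2) * z ^+ 2 <= al ^+ 2 + be ^+ 2.
Proof.
move=> z1.
have z2 : 0 <= z ^+ 2 <= 1.
  by rewrite sqr_ge0/= -(real_normK (num_real z)) exprn_ile1.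
have := sqr_ge0 al; have := sqr_ge0 be; case/andP: z2; set u := z ^+ 2.
by move=> *; apply/andP; split; nra.
Qed.

Lemma radial_step_ge0 al be s z : 0 <= s -> `|z| <= 1 ->
  0 <= radial_step al be s z.
Proof.
move=> s0 z1.
have -> : radial_step al be s z =
    (Num.sqrt s + al * z) ^+ 2 + be ^+ 2 * (1 - z ^+ 2).
  by rewrite /radial_step -{1}(sqr_sqrtr s0); ring.
rewrite addr_ge0 ?sqr_ge0// mulr_ge0 ?sqr_ge0// subr_ge0.
by rewrite -(real_normK (num_real z)) exprn_ile1.
Qed.

(** The increment is measured relative to a scale [y >= s]: with [y] a shift of [s] the expansion is
    uniform down to [s = 0], and [y = s] gives the usual one. The factor [rho] is the square root of
    [s / y]. *)
Lemma radial_scaled al be s y z : 0 <= s <= y -> 1 <= y -> `|z| <= 1 ->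
  0 < al -> 0 < be ->
  let c := 2 * al + al ^+ 2 + be ^+ 2 in
  let r := (Num.sqrt y)^-1 in let rho := Num.sqrt s * r in
  let P := 2 * al * rho * r * z in
  let Q := r ^+ 2 * (be ^+ 2 + (al ^+ 2 - be ^+ 2) * z ^+ 2) in
  [/\ radial_step al be s z = s + y * (P + Q), 0 <= r <= 1,
      `|P| <= c * r, 0 <= Q <= c * r ^+ 2 & `|P + Q| <= c * r].
Proof.
move=> /andP[s0 sy] y1 z1 al0 be0 c r rho P Q.
have y0 : 0 < y by lra.
have sqy : 1 <= Num.sqrt y by have := ler_wsqrtr y1; rewrite sqrtr1.
have r01 : 0 < r <= 1.
  by rewrite invr_gt0 (lt_le_trans ltr01 sqy)/= invf_le1// (lt_le_trans ltr01).
have /andP[r0 r1] := r01.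
have yr2 : y * r ^+ 2 = 1.
  by rewrite /r exprVn sqr_sqrtr ?divff//; lra.
have /andP[q0 q1] := @quadratic_part_bounds al be z z1.
have rho0 : 0 <= rho by rewrite mulr_ge0 ?sqrtr_ge0// ltW.
have rho1 : rho <= 1.
  by rewrite /rho /r ler_pdivrMr ?mul1r ?ler_sqrt//; lra.
have Pb : `|P| <= 2 * al * r.
  rewrite /P 4!normrM (@ger0_norm _ 2)// (gtr0_norm al0) (ger0_norm rho0).
  rewrite (gtr0_norm r0).
  have -> : 2 * al * r = 2 * al * 1 * r * 1 by ring.
  by rewrite !ler_pM// ?mulr_ge0// ?ltW// ler_pM2l//; lra.
have Qb : 0 <= Q <= (al ^+ 2 + be ^+ 2) * r ^+ 2.
  rewrite /Q mulr_ge0 ?sqr_ge0//= mulrC ler_wpM2r// sqr_ge0//.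
have /andP[Q0 Q1] := Qb.
have a2 := sqr_ge0 al; have b2 := sqr_ge0 be; have r2 := sqr_ge0 r.
have rr : r ^+ 2 <= r by rewrite expr2 ger_pMr.
split.
- have -> : y * (P + Q) = (y * r ^+ 2) *
      (2 * al * Num.sqrt s * z + (be ^+ 2 + (al ^+ 2 - be ^+ 2) * z ^+ 2)).
    by rewrite /P /Q /rho; ring.
  by rewrite yr2 /radial_step; ring.
- by rewrite ltW.
- apply: le_trans Pb _; rewrite ler_wpM2r ?(ltW r0)// /c; lra.
- rewrite Q0 (le_trans Q1)// ler_wpM2r// /c; lra.
- apply: le_trans (ler_normD _ _) _; rewrite (ger0_norm Q0).
  apply: le_trans (lerD Pb Q1) _.
  have : (al ^+ 2 + be ^+ 2) * r ^+ 2 <= (al ^+ 2 + be ^+ 2) * r.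
    by rewrite ler_wpM2l//; lra.
  by rewrite /c; lra.
Qed.

(** The condition [4 * c ^+ 2 <= y] amounts to [c * r <= 1/2], the range in which the logarithm is
    expanded. The same shift [y - s] is added before and after the step. *)
Lemma radial_log al be s y z : 0 <= s <= y -> 1 <= y -> `|z| <= 1 ->
  0 < al -> 0 < be ->
  let c := 2 * al + al ^+ 2 + be ^+ 2 in 4 * c ^+ 2 <= y ->
  let r := (Num.sqrt y)^-1 in let rho := Num.sqrt s * r in
  let P := 2 * al * rho * r * z in
  let Q := r ^+ 2 * (be ^+ 2 + (al ^+ 2 - be ^+ 2) * z ^+ 2) in
  let C := 3 * c ^+ 2 + 3 * c ^+ 3 in
  exists l, [/\ ln (y - s + radial_step al be s z) = ln y + l, `|l| <= 1,
      `|l - (P + Q - P ^+ 2 / 2)| <= C * r ^+ 3,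
      l ^+ 2 <= 4 * c ^+ 2 * r ^+ 2 & P ^+ 2 - C * r ^+ 3 <= l ^+ 2].
Proof.
move=> sy y1 z1 al0 be0 c cy r rho P Q C.
have [E r01 hP hQ hX] := radial_scaled sy y1 z1 al0 be0.
rewrite -/c -/r -/rho -/P -/Q in E r01 hP hQ hX.
have c0 : 0 < c by rewrite /c; have := sqr_ge0 al; have := sqr_ge0 be; lra.
have y0 : 0 < y by lra.
have cr : c * r <= 2^-1.
  rewrite /r ler_pdivrMr ?sqrtr_gt0// mulrC ler_pdivlMr//.
  rewrite -(@ler_pXn2r _ 2)// ?nnegrE ?sqrtr_ge0//; last lra.
  rewrite sqr_sqrtr ?(ltW y0)// exprMn -natrX /=.
  move: cy; lra.
have [h1 h2 h3] := ln1D_split r01 cr hP hQ hX.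
have X0 : 0 < 1 + (P + Q).
  by have := le_trans hX cr; rewrite ler_norml => /andP[u _]; lra.
exists (ln (1 + (P + Q))); split => //.
- rewrite -lnM ?posrE//; congr ln; rewrite E; ring.
- rewrite -(@ler_pXn2r _ 2)// ?nnegrE// real_normK ?num_real// expr1n.
  apply: le_trans h2 _.
  have -> : 4 * c ^+ 2 * r ^+ 2 = (2 * (c * r)) ^+ 2 by ring.
  rewrite exprn_ile1//; last lra.
  by rewrite mulr_ge0// mulr_ge0 ?(ltW c0)//; case/andP: r01.
Qed.

(** From [1/(L + l) = 1/L - l/L^2 + l^2/(L^2 (L + l))], where [L + l >= L/2]. *)
Lemma invD_le L l : 2 <= L -> `|l| <= 1 ->
  (L + l)^-1 <= L^-1 - l / L ^+ 2 + 2 * l ^+ 2 / L ^+ 3.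
Proof.
move=> L2; rewrite ler_norml => /andP[l1 l2].
have -> : (L + l)^-1 = L^-1 - l / L ^+ 2 + l ^+ 2 / (L ^+ 2 * (L + l)).
  by field; apply/andP; split; lra.
rewrite lerD2l ler_pdivrMr; last by rewrite mulr_gt0 ?exprn_gt0//; lra.
have -> : 2 * l ^+ 2 / L ^+ 3 * (L ^+ 2 * (L + l)) =
    l ^+ 2 * (2 * (L + l) / L) by field; lra.
by rewrite -[leLHS]mulr1 ler_wpM2l ?sqr_ge0// ler_pdivlMr; lra.
Qed.

(* The shift [c] is what makes the drift negative for all [s], not only for
   large [s]. *)
Lemma transient_drift al be v : 0 < al -> 0 < be -> 0 <= v ->
  al ^+ 2 * v < be ^+ 2 * (1 - v) ->
  exists c eta, [/\ 2 <= c, 0 < eta & forall s, 0 <= s ->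
    quad_le v (fun z => (ln (c + radial_step al be s z))^-1)
              ((ln (c + s))^-1 - eta / (c + s) ^+ 3)].
Proof.
move=> al0 be0 v0 hv.
pose c := 2 * al + al ^+ 2 + be ^+ 2.
pose C := 3 * c ^+ 2 + 3 * c ^+ 3.
have c0 : 0 < c by rewrite /c; have := sqr_ge0 al; have := sqr_ge0 be; lra.
have C0 : 0 < C by rewrite /C addr_gt0// mulr_gt0// exprn_gt0.
pose eta := (be ^+ 2 * (1 - v) - al ^+ 2 * v) / 2.
have eta0 : 0 < eta by rewrite /eta; lra.
have etaE : 2 * eta = be ^+ 2 * (1 - v) - al ^+ 2 * v by rewrite /eta; lra.
clearbody eta.
(* [4 * c ^+ 2] validates the expansion of the logarithm, [(2 * C / eta) ^+ 2] makes [C * r] at most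
   [eta / 2], and the exponential makes [ln y] so large that the second-order term of the inverse
   costs at most [eta / 2] too. *)
pose c' := 1 + 4 * c ^+ 2 + (2 * C / eta) ^+ 2 + expR (2 + 16 * c ^+ 2 / eta).
have e1 : 0 < 2 * C / eta by rewrite divr_gt0// mulr_gt0.
have e2 : 0 < 16 * c ^+ 2 / eta by rewrite divr_gt0// mulr_gt0// exprn_gt0.
have e3 := sqr_ge0 c; have e4 := sqr_ge0 (2 * C / eta).
have e5 := @expR_ge1Dx R (2 + 16 * c ^+ 2 / eta).
exists c', eta; split => //; first by rewrite /c'; lra.
move=> s s0; set y := c' + s.
have yc' : c' <= y by rewrite /y; lra.
have y1 : 1 <= y by move: yc'; rewrite /c'; lra.
have y0 : 0 < y by lra.
have yc : 4 * c ^+ 2 <= y by move: yc'; rewrite /c'; lra.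
have sy : 0 <= s <= y by rewrite s0 /y; move: yc'; rewrite /y /c'; lra.
set L := ln y.
have hL : 2 + 16 * c ^+ 2 / eta <= L.
  rewrite -(expRK (2 + _)) /L ler_ln ?posrE ?expR_gt0//.
  by move: yc'; rewrite /c'; lra.
have L2 : 2 <= L by lra.
have L0 : 0 < L by lra.
pose r := (Num.sqrt y)^-1; pose rho := Num.sqrt s * r.
have sqy0 : 0 < Num.sqrt y by rewrite sqrtr_gt0.
have r0 : 0 < r by rewrite invr_gt0.
have r2 : r ^+ 2 = y^-1 by rewrite /r exprVn sqr_sqrtr// ltW.
have rho1 : rho ^+ 2 <= 1.
  rewrite /rho exprMn r2 sqr_sqrtr// ler_pdivrMr ?mul1r//.
  by case/andP: sy.
have Cr : C * r <= eta / 2.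
  rewrite /r ler_pdivrMr// -ler_pdivrMl ?divr_gt0//.
  rewrite -(@ler_pXn2r _ 2)// ?nnegrE ?sqrtr_ge0//; last first.
    by rewrite ltW// mulr_gt0// invr_gt0 divr_gt0.
  rewrite sqr_sqrtr ?(ltW y0)//.
  have -> : (eta / 2)^-1 * C = 2 * C / eta by field; lra.
  by move: yc'; rewrite /c'; have := expR_gt0 (2 + 16 * c ^+ 2 / eta); lra.
have CL : 8 * c ^+ 2 / L <= eta / 2.
  rewrite ler_pdivrMr// -ler_pdivrMl ?divr_gt0//.
  have -> : (eta / 2)^-1 * (8 * c ^+ 2) = 16 * c ^+ 2 / eta by field; lra.
  lra.
pose iL := (L ^+ 2)^-1.
have iL0 : 0 < iL by rewrite invr_gt0 exprn_gt0.
(* Coefficients of the bound [invD_le] once the expansion of [l] is inserted; [l ^+ 2] enters only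
   through a bound uniform in [z]. *)
exists (- iL * (2 * al * rho * r)).
exists (- iL *
  (r ^+ 2 * (al ^+ 2 - be ^+ 2) - 2 * al ^+ 2 * rho ^+ 2 * r ^+ 2)).
exists (L^-1 - iL * (r ^+ 2 * be ^+ 2 - C * r ^+ 3) +
   iL * (8 * c ^+ 2 * r ^+ 2 / L)).
split.
- move=> z z1.
  have [l [El l1 h1 h2 _]] := radial_log sy y1 z1 al0 be0 yc.
  have -> : c' + radial_step al be s z = y - s + radial_step al be s z.
    by rewrite /y; ring.
  rewrite El -/L; apply: le_trans (invD_le L2 l1) _.
  move/ler_normlP: h1 => [h1 _]; rewrite -/c -/C -/r -/rho in h1 h2.
  have -> : 2 * l ^+ 2 / L ^+ 3 = iL * (2 * l ^+ 2 / L).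
    by rewrite /iL; field; lra.
  rewrite (mulrC l) -/iL.
  have k1 : iL * (2 * l ^+ 2 / L) <= iL * (8 * c ^+ 2 * r ^+ 2 / L).
    by rewrite ler_pM2l// ler_pM2r ?invr_gt0//; lra.
  apply: le_trans (lerD (lexx _) k1) _.
  have k2 := ler_wpM2l (ltW iL0) h1.
  set W := iL * (_ / L); clearbody iL W r rho.
  move: k2; set iL1 := L^-1; lra.
- have -> : forall A B : R,
    (- iL * A * v + (L^-1 - iL * B + iL * (8 * c ^+ 2 * r ^+ 2 / L))) =
    L^-1 - iL * (A * v + B - 8 * c ^+ 2 / L * r ^+ 2) by move=> A B; field; lra.
  rewrite lerD2l lerN2.
  (* The order [1 / (y * L ^+ 2)] is weakened to [1 / y ^+ 3] by [L <= y]; any such power still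
     forces divergence later. *)
  have -> : eta / y ^+ 3 = (y ^+ 2)^-1 * (eta * r ^+ 2).
    by rewrite r2; field; lra.
  apply: ler_pM.
  + by rewrite invr_ge0 sqr_ge0.
  + by rewrite mulr_ge0 ?sqr_ge0// ltW.
  + rewrite /iL lef_pV2 ?posrE ?exprn_gt0//.
    rewrite lerXn2r ?nnegrE ?(ltW L0) ?(ltW y0)//.
    by rewrite ltW// ln_sublinear.
  have -> :
     (r ^+ 2 * (al ^+ 2 - be ^+ 2) - 2 * al ^+ 2 * rho ^+ 2 * r ^+ 2) * v +
     (r ^+ 2 * be ^+ 2 - C * r ^+ 3) - 8 * c ^+ 2 / L * r ^+ 2 =
     ((al ^+ 2 - be ^+ 2) * v + be ^+ 2 - 2 * (al ^+ 2 * v) * rho ^+ 2 - C * r -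
      8 * c ^+ 2 / L) * r ^+ 2.
    by rewrite [r ^+ 3]exprS; ring.
  rewrite ler_wpM2r ?sqr_ge0//.
  (* The worst case is [rho = 1], where the main term is [2 * eta]; the two errors take at most
     [eta / 2] each. *)
  have : (al ^+ 2 * v) * rho ^+ 2 <= al ^+ 2 * v.
    by rewrite -[leRHS]mulr1 ler_wpM2l// mulr_ge0// sqr_ge0.
  by lra.
Qed.

Lemma sqrt_ln_le y : 0 <= y -> Num.sqrt (ln y) <= 1 + y.
Proof.
rewrite le_eqVlt => /predU1P[<-|y0]; first by rewrite ln0// sqrtr0; lra.
have -> : 1 + y = Num.sqrt ((1 + y) ^+ 2) by rewrite sqrtr_sqr ger0_norm//; lra.
apply: ler_wsqrtr; apply: le_trans (ltW (ln_sublinear y0)) _.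
by rewrite sqrrD; have := sqr_ge0 y; lra.
Qed.

(** With [u] and [w] the square roots of [L] and [L + l], [2 * u * (w - u) = l - (w - u) ^+ 2], and
    [(w - u) ^+ 2 = l ^+ 2 / (w + u) ^+ 2] where [(w + u) ^+ 2 <= 2 * (2 * L + l) <= 6 * L]. The
    negative square is the gain from concavity. *)
Lemma sqrtD_le L l : 1 <= L -> `|l| <= 1 ->
  Num.sqrt (L + l) <=
    Num.sqrt L + (l - l ^+ 2 / (6 * L)) / (2 * Num.sqrt L).
Proof.
move=> L1; rewrite ler_norml => /andP[l1 l2].
have L0 : 0 < L by lra.
set u := Num.sqrt L; set w := Num.sqrt (L + l).
have u0 : 0 < u by rewrite sqrtr_gt0.
have w0 : 0 <= w := sqrtr_ge0 _.
have uE : u ^+ 2 = L by rewrite sqr_sqrtr// ltW.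
have wE : w ^+ 2 = L + l by rewrite sqr_sqrtr//; lra.
rewrite -lerBlDl ler_pdivlMr ?mulr_gt0//.
have -> : (w - u) * (2 * u) = l - (w - u) ^+ 2.
  by rewrite (_ : l = w ^+ 2 - u ^+ 2); [ring|lra].
rewrite lerD2l lerN2 ler_pdivrMr ?mulr_gt0//.
have -> : l ^+ 2 = (w - u) ^+ 2 * (w + u) ^+ 2.
  by rewrite -exprMn (_ : l = w ^+ 2 - u ^+ 2); [ring|lra].
rewrite ler_wpM2l ?sqr_ge0//.
have := sqr_ge0 (w - u); rewrite sqrrB sqrrD; lra.
Qed.

(** With a fourth root on the right, [ln y / Num.sqrt y] is seen to be small for large [y]. *)
Lemma ln_le_root4 y : 1 <= y -> ln y <= 4 * Num.sqrt (Num.sqrt y).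
Proof.
move=> y1; set w := Num.sqrt (Num.sqrt y).
have y0 : 0 < y by lra.
have w0 : 0 < w by rewrite !sqrtr_gt0.
have -> : y = w ^+ 4.
  by rewrite (exprM w 2 2) !sqr_sqrtr ?sqrtr_ge0// ltW.
by rewrite lnXn// -[ln w *+ 4]mulr_natl ler_pM2l// ltW// ln_sublinear.
Qed.

(* In the critical case the terms of order [1 / s] cancel in the drift of
   [ln s]; the concavity of [sqrt] contributes a negative term of order
   [1 / (s * ln s)], which beats the Taylor remainder of order [s ^ (-3/2)]. *)
Lemma recurrent_drift al be v : 0 < al -> 0 < be -> 0 < v ->
  be ^+ 2 * (1 - v) <= al ^+ 2 * v ->
  exists s0 kap, [/\ 2 <= s0, 0 < kap & forall s, s0 <= s ->
    quad_le v (fun z => Num.sqrt (ln (radial_step al be s z)))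
              (Num.sqrt (ln s) - kap / s ^+ 3)].
Proof.
move=> al0 be0 v0 hv.
pose c := 2 * al + al ^+ 2 + be ^+ 2.
pose C := 3 * c ^+ 2 + 3 * c ^+ 3.
have c0 : 0 < c by rewrite /c; have := sqr_ge0 al; have := sqr_ge0 be; lra.
have C0 : 0 < C by rewrite /C addr_gt0// mulr_gt0// exprn_gt0.
have av0 : 0 < al ^+ 2 * v by rewrite mulr_gt0// exprn_gt0.
(* [4 * c ^+ 2] validates the expansion of the logarithm, the fourth power makes the Taylor
   remainder at most half of the concavity gain, and [expR 1] gives [1 <= ln y]. *)
pose s0 := 1 + 4 * c ^+ 2 + (24 * C / (al ^+ 2 * v)) ^+ 4 + expR 1.
have e1 : 0 < 24 * C / (al ^+ 2 * v) by rewrite divr_gt0// mulr_gt0.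
have e3 := sqr_ge0 c; have e4 := exprn_ge0 4 (ltW e1).
have e5 := @expR_ge1Dx R 1.
exists s0, (al ^+ 2 * v / 6); split; first by rewrite /s0; lra.
  by rewrite divr_gt0.
move=> y ys0.
have y1 : 1 <= y by move: ys0; rewrite /s0; lra.
have y0 : 0 < y by lra.
have yc : 4 * c ^+ 2 <= y by move: ys0; rewrite /s0; lra.
have yy : 0 <= y <= y by rewrite lexx ltW.
set L := ln y.
have L1 : 1 <= L.
  rewrite -(expRK 1) /L ler_ln ?posrE ?expR_gt0//.
  by move: ys0; rewrite /s0; lra.
have L0 : 0 < L by lra.
pose r := (Num.sqrt y)^-1.
have sqy0 : 0 < Num.sqrt y by rewrite sqrtr_gt0.
have r0 : 0 < r by rewrite invr_gt0.
have r2 : r ^+ 2 = y^-1 by rewrite /r exprVn sqr_sqrtr// ltW.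
have rho1 : Num.sqrt y * r = 1 by rewrite /r divff// gt_eqF.
have Cr : 2 * C * r * L <= al ^+ 2 * v / 3.
  have := ln_le_root4 y1; rewrite -/L; set w := Num.sqrt (Num.sqrt y) => Lw.
  have w0 : 0 < w by rewrite !sqrtr_gt0.
  have rw : r = (w ^+ 2)^-1 by rewrite /r sqr_sqrtr ?sqrtr_ge0.
  have hw : 24 * C / (al ^+ 2 * v) <= w.
    rewrite -(@ler_pXn2r _ 4)// ?nnegrE ?(ltW e1) ?(ltW w0)//.
    rewrite (exprM w 2 2) !sqr_sqrtr ?sqrtr_ge0 ?(ltW y0)//.
    by move: ys0; rewrite /s0; have := expR_gt0 (1 : R); lra.
  apply: (@le_trans _ _ (2 * C * r * (4 * w))).
    by rewrite ler_pM2l// !mulr_gt0.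
  have -> : 2 * C * r * (4 * w) = 8 * C / w.
    by rewrite rw; field; rewrite gt_eqF.
  rewrite ler_pdivrMr// -ler_pdivrMl ?divr_gt0//.
  have -> // : (al ^+ 2 * v / 3)^-1 * (8 * C) = 24 * C / (al ^+ 2 * v).
  by field; rewrite !gt_eqF.
set u := Num.sqrt L.
have u0 : 0 < u by rewrite sqrtr_gt0.
pose i := (2 * u)^-1.
have i0 : 0 < i by rewrite invr_gt0 mulr_gt0.
(* Here [i] is the derivative of the square root at [L]; the term over [6 * L] in the next
   coefficient is the concavity gain of [sqrtD_le]. *)
exists (i * (2 * al * r)).
exists (i * (r ^+ 2 * (al ^+ 2 - be ^+ 2) - 2 * al ^+ 2 * r ^+ 2
             - (4 * al ^+ 2 * r ^+ 2) / (6 * L))).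
exists (u + i * (r ^+ 2 * be ^+ 2 + 2 * C * r ^+ 3)).
split.
- move=> z z1.
  have [l [El l1 h1 _ h3]] := radial_log yy y1 z1 al0 be0 yc.
  rewrite -/c -/C -/r rho1 mulr1 in h1 h3.
  move: El; rewrite subrr add0r => ->; rewrite -/L.
  apply: le_trans (sqrtD_le L1 l1) _; rewrite -/u -/i.
  move/ler_normlP: h1 => [_ h1].
  have h3' : - (l ^+ 2 / (6 * L)) <=
      - ((2 * al * r * z) ^+ 2 / (6 * L)) + C * r ^+ 3.
    have : ((2 * al * r * z) ^+ 2 - C * r ^+ 3) / (6 * L) <= l ^+ 2 / (6 * L).
      by rewrite ler_pM2r// invr_gt0 mulr_gt0.
    have : C * r ^+ 3 / (6 * L) <= C * r ^+ 3.
      rewrite -[leRHS]mulr1.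
      rewrite ler_wpM2l ?mulr_ge0 ?exprn_ge0 ?(ltW C0) ?(ltW r0)//.
      by rewrite invf_le1 ?mulr_gt0//; lra.
    by rewrite mulrBl; lra.
  have k := lerD h1 h3'.
  have {}k : l - l ^+ 2 / (6 * L) <= (2 * al * r * z) +
     r ^+ 2 * (be ^+ 2 + (al ^+ 2 - be ^+ 2) * z ^+ 2) -
     (2 * al * r * z) ^+ 2 / 2 - (2 * al * r * z) ^+ 2 / (6 * L) +
     2 * C * r ^+ 3.
    by move: k; set q := l ^+ 2 / _; set q' := _ / (6 * L); lra.
  move: k; rewrite -(ler_pM2l i0) [(_ - _) * i]mulrC => k.
  apply: le_trans (lerD (lexx u) k) _.
  clearbody i u L; set iL := (6 * L)^-1; lra.
- have -> : i * (r ^+ 2 * (al ^+ 2 - be ^+ 2) - 2 * al ^+ 2 * r ^+ 2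
             - (4 * al ^+ 2 * r ^+ 2) / (6 * L)) * v +
      (u + i * (r ^+ 2 * be ^+ 2 + 2 * C * r ^+ 3)) =
     u - i * r ^+ 2 * (al ^+ 2 * v - be ^+ 2 * (1 - v) +
       (2 / 3 * (al ^+ 2 * v) - 2 * C * r * L) / L).
    by rewrite [r ^+ 3]exprS; field; rewrite gt_eqF.
  rewrite lerD2l lerN2 r2.
  (* The first difference is nonnegative by hypothesis and zero in the critical case. Of the gain
     [2 / 3 * (al ^+ 2 * v)], the remainder consumes at most half. *)
  have h : (al ^+ 2 * v / 3) / L <= al ^+ 2 * v - be ^+ 2 * (1 - v) +
       (2 / 3 * (al ^+ 2 * v) - 2 * C * r * L) / L.
    rewrite -[leLHS]add0r lerD//; first lra.
    by rewrite ler_pM2r ?invr_gt0//; lra.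
  apply: (@le_trans _ _ (i / y * (al ^+ 2 * v / 3 / L))); last first.
    by rewrite ler_pM2l// divr_gt0.
  have -> : i / y * (al ^+ 2 * v / 3 / L) = (al ^+ 2 * v / 6) / (u * L * y).
    by rewrite /i; field; rewrite !gt_eqF.
  rewrite ler_pM2l ?divr_gt0// lef_pV2 ?posrE ?mulr_gt0 ?exprn_gt0//.
  rewrite [leRHS]exprSr ler_pM2r// expr2 ler_pM ?(ltW u0) ?(ltW L0)//.
    rewrite -(@ler_pXn2r _ 2)// ?nnegrE ?(ltW u0) ?(ltW y0)//.
    rewrite sqr_sqrtr ?(ltW L0)//; apply: le_trans (ltW (ln_sublinear y0)) _.
    by rewrite expr2 ler_peMr// ltW.
  exact: ltW (ln_sublinear y0).
Qed.

(** The shifted radius drifts outwards whatever [al] and [be]: to leading order, concavity takes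
    away at most the radial contribution [al ^+ 2 * v] to the drift of [s], and the transversal
    contribution [be ^+ 2 * (1 - v)] remains. *)
Lemma null_drift al be v : 0 < al -> 0 < be -> 0 <= v -> v < 1 ->
  exists c eta, [/\ 1 <= c, 0 < eta & forall s, 0 <= s ->
    quad_le v (fun z => - Num.sqrt (c + radial_step al be s z))
              (- (Num.sqrt (c + s) + eta / Num.sqrt (c + s)))].
Proof.
move=> al0 be0 v0 v1.
pose c := 2 * al + al ^+ 2 + be ^+ 2.
have c0 : 0 < c by rewrite /c; have := sqr_ge0 al; have := sqr_ge0 be; lra.
have [eta eta0 etaE] : exists2 eta, 0 < eta & 2 * eta = be ^+ 2 * (1 - v).
  exists (be ^+ 2 * (1 - v) / 2); last lra.
  by rewrite divr_gt0// mulr_gt0 ?exprn_gt0//; lra.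
have av0 : 0 <= al ^+ 2 * v by rewrite mulr_ge0 ?sqr_ge0.
(* For [t > c + K], having [2 * t - c] instead of [2 * t] in [w] and the extra error
   [3 * c ^+ 2 * t] together cost at most [eta], half of the available drift [2 * eta]. *)
pose K := (3 * c ^+ 2 + 4 * c * (al ^+ 2 * v + eta)) / (4 * eta).
have K0 : 0 < K.
  by rewrite divr_gt0 ?mulr_gt0// addr_gt0 ?mulr_gt0 ?exprn_gt0//; lra.
exists (1 + (c + K) ^+ 2), (eta / 2).
have q0 := sqr_ge0 (c + K).
split; [lra|by rewrite divr_gt0|move=> s s0].
set c' := 1 + _; set y := c' + s.
have y1 : 1 <= y by rewrite /y /c'; lra.
have y0 : 0 < y by lra.
have sy : 0 <= s <= y by rewrite s0 /y /c'; lra.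
set t := Num.sqrt y.
have t0 : 0 < t by rewrite sqrtr_gt0.
have tE : t ^+ 2 = y by rewrite sqr_sqrtr// ltW.
have cKt : c + K < t.
  rewrite -(@ltr_pXn2r _ 2)// ?nnegrE ?(ltW t0)//; last lra.
  by rewrite tE /y /c'; lra.
pose r := t^-1; pose rho := Num.sqrt s * r.
have r0 : 0 < r by rewrite invr_gt0.
have rho1 : rho ^+ 2 <= 1.
  rewrite /rho exprMn sqr_sqrtr// /r exprVn tE ler_pdivrMr ?mul1r//.
  by case/andP: sy.
have w0 : 0 < 2 * t - c by lra.
pose w := ((2 * t - c) ^+ 2)^-1.
have w1 : 0 < w by rewrite invr_gt0 exprn_gt0.
have hw : w * (4 * (al ^+ 2 * v) * y + 3 * c ^+ 2 * t) <= al ^+ 2 * v + eta.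
  rewrite /w mulrC ler_pdivrMr ?exprn_gt0// -tE.
  have : (3 * c ^+ 2 + 4 * c * (al ^+ 2 * v + eta)) * t <= 4 * eta * t * t.
    rewrite ler_pM2r// -ler_pdivrMl ?mulr_gt0// mulrC -/K; lra.
  have := mulr_ge0 (addr_ge0 av0 (ltW eta0)) (sqr_ge0 c).
  lra.
pose i := (2 * t)^-1.
have i0 : 0 < i by rewrite invr_gt0 mulr_gt0.
exists (- (i * (y * (2 * al * rho * r)))).
exists (- (i * (y * (r ^+ 2 * (al ^+ 2 - be ^+ 2)))) +
  i * w * (y ^+ 2 * (2 * al * rho * r) ^+ 2)).
exists (- t - i * (y * (r ^+ 2 * be ^+ 2)) +
  i * w * (y ^+ 2 * (3 * c ^+ 2 * r ^+ 3))).
have yr : y * r ^+ 2 = 1 by rewrite -tE /r exprVn divff// expf_eq0/= gt_eqF.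
split.
- move=> z z1.
  have [E r01 hP hQ hX] := radial_scaled sy y1 z1 al0 be0.
  have hD := sqrD_err r01 hP hQ.
  rewrite -/c -/t -/r -/rho in E r01 hP hQ hX hD.
  set P := 2 * al * rho * r * z in E hP hX hD *.
  set Q := r ^+ 2 * _ in E hQ hX hD *.
  have -> : c' + radial_step al be s z = y + y * (P + Q) by rewrite E /y; ring.
  have S0 := radial_step_ge0 al be s0 z1.
  set t' := Num.sqrt _.
  have t'0 : 0 <= t' := sqrtr_ge0 _.
  have t'E : t' ^+ 2 = y + y * (P + Q).
    by rewrite sqr_sqrtr//; move: S0; rewrite E /y /c'; lra.
  have dE : (t' - t) * (t' + t) = y * (P + Q).
    by rewrite -subr_sqr t'E tE; ring.
  (* One step moves the shifted radius by at most [c]; hence [t' + t >= 2 * t - c], and [w] bounds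
     the inverse square of [t' + t]. *)
  have dc : t - c <= t'.
    have : `|t' - t| * t <= c * t.
      apply: (@le_trans _ _ (`|t' - t| * (t' + t))).
        by rewrite ler_wpM2l//; lra.
      rewrite -{1}(@ger0_norm _ (t' + t)); last lra.
      rewrite -normrM dE normrM (gtr0_norm y0).
      have -> : c * t = y * (c * r) by rewrite -tE /r; field; rewrite gt_eqF.
      by rewrite ler_pM2l.
    by rewrite ler_pM2r// => /ler_normlP[]; lra.
  have d2 : (t' - t) ^+ 2 <= w * (y ^+ 2 * (P ^+ 2 + 3 * c ^+ 2 * r ^+ 3)).
    rewrite /w mulrC ler_pdivlMr ?exprn_gt0//.
    apply: (@le_trans _ _ ((t' - t) ^+ 2 * (t' + t) ^+ 2)).
      by rewrite ler_wpM2l ?sqr_ge0// lerXn2r// ?nnegrE; lra.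
    rewrite -exprMn dE exprMn ler_wpM2l ?sqr_ge0//.
    by move/ler_normlP: hD => []; lra.
  have -> : t' = t + i * (y * (P + Q) - (t' - t) ^+ 2).
    rewrite -dE /i; field; rewrite gt_eqF//.
  have := ler_wpM2l (ltW i0) d2; rewrite /P /Q.
  clearbody t' t w i r rho y; lra.
- have -> : (- (i * (y * (r ^+ 2 * (al ^+ 2 - be ^+ 2)))) +
     i * w * (y ^+ 2 * (2 * al * rho * r) ^+ 2)) * v +
    (- t - i * (y * (r ^+ 2 * be ^+ 2)) +
     i * w * (y ^+ 2 * (3 * c ^+ 2 * r ^+ 3)))
    = - t - i * ((y * r ^+ 2) * ((al ^+ 2 - be ^+ 2) * v + be ^+ 2) -
       w * (4 * (al ^+ 2 * v) * rho ^+ 2 * y * (y * r ^+ 2) +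
            3 * c ^+ 2 * (y * (y * r ^+ 2) * r))) by ring.
  rewrite yr mul1r !mulr1.
  have -> : y * r = t by rewrite -tE /r; field; rewrite gt_eqF.
  rewrite opprD lerD2l lerN2.
  have -> : eta / 2 / t = i * eta by rewrite /i; field; rewrite gt_eqF.
  rewrite ler_pM2l//.
  have : w * (4 * (al ^+ 2 * v) * rho ^+ 2 * y + 3 * c ^+ 2 * t) <=
         w * (4 * (al ^+ 2 * v) * y + 3 * c ^+ 2 * t).
    rewrite ler_pM2l// lerD2r ler_pM2r// -[leRHS]mulr1 ler_wpM2l//.
    by rewrite mulr_ge0.
  lra.
Qed.

End drift.

(** * Chains driven by independent noise *)

Section driven_chain.
Context {disp : measure_display} {T : measurableType disp} {R : realType}.
Variables (P : probability T R) (z : nat -> T -> R).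

(** Cylinder events on the noise before time [n]: a family closed under intersection, which
    generates the history [<<s past n>>]. *)
Definition past (n : nat) : set (set T) :=
  [set A | exists2 B : nat -> set R, forall k, measurable (B k) &
    A = \bigcap_(k in `I_n) (z k @^-1` B k)].

(** The rule [G] may depend on time, so that a chain frozen only after a given time is also of this
    form. *)
Fixpoint driven_chain (G : nat -> R -> R -> R) (y0 : R) (n : nat) (w : T) : R :=
  if n is m.+1 then G m (driven_chain G y0 m w) (z m w) else y0.

Hypothesis mz : forall n, measurable_fun setT (z n).
Hypothesis indz : forall n (B : nat -> set R), (forall k, measurable (B k)) ->
  P (\bigcap_(k in `I_n) (z k @^-1` B k)) =
  (\prod_(k < n) P (z k @^-1` B k))%E.

Lemma measurable_past n A : past n A -> measurable A.
Proof.
case=> B mB ->; apply: bigcap_measurableType => //.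
by move=> k _; rewrite -[X in measurable X]setTI; exact: mz.
Qed.

(** Both sides are finite measures in [A] that agree on cylinders by [indz]; uniqueness on a
    generating pi-system extends this to the whole history. *)
Lemma past_indep n (A : set T) (B : set R) : <<s past n >> A -> measurable B ->
  P (A `&` z n @^-1` B) = (P A * P (z n @^-1` B))%E.
Proof.
move=> pA mB; set F := z n @^-1` B.
have mF : measurable F by rewrite -[X in measurable X]setTI; exact: mz.
have PF0 : 0 <= fine (P F) by apply: fine_ge0; exact: measure_ge0.
have PFE : (fine (P F))%:E = P F by rewrite fineK// fin_num_measure.
have -> : (P A * P F)%E = mscale (NngNum PF0) P A.
  by rewrite /mscale/= PFE muleC.
apply: (g_sigma_algebra_measure_unique (past n) _ (fun=> setT) _ _ (mrestr P mF)
  (mscale (NngNum PF0) P)) => //.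
- exact: measurable_past.
- by move=> _; exists (fun=> setT) => //; apply/seteqP; split.
- by rewrite bigcup_const//; exists 0%N.
- move=> _ _ [B1 mB1 ->] [B2 mB2 ->]; exists (fun k => B1 k `&` B2 k).
    by move=> k; exact: measurableI.
  by rewrite -bigcapI.
- move=> _ [C mC ->]; rewrite /mrestr/= /mscale/= PFE.
  (* The cylinder receives [B] as one more factor, so that [indz] at [n.+1] computes the
     intersection. *)
  pose D k := if k == n then B else C k.
  have mD k : measurable (D k) by rewrite /D; case: ifPn.
  have ltD k : (k < n)%N -> D k = C k by rewrite /D; case: ltngtP.
  have DB : D n = B by rewrite /D eqxx.
  have := indz n.+1 mD; rewrite big_ord_recr/=.
  rewrite DB.
  under eq_bigr => k _ do rewrite ltD//.
  rewrite -indz// [RHS]muleC => <-; congr (P _).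
  apply/seteqP; split => w /=.
    move=> [h Fw] k; rewrite /= ltnS leq_eqVlt => /predU1P[->|kn].
      by rewrite DB.
    by rewrite ltD//; exact: h.
  move=> h; split; last by have := h n (ltnSn n); rewrite DB.
  by move=> k kn; have := h k (ltnW kn : (k < n.+1)%N); rewrite ltD.
- move=> _; have : (P (setT `&` F) < +oo)%E => //.
  by rewrite setTI ltey_eq fin_num_measure.
Qed.

Lemma past_recS n A : past n A -> past n.+1 A.
Proof.
case=> B mB ->; exists (fun k => if (k < n)%N then B k else setT).
  by move=> k; case: ifPn.
apply/seteqP; split => w /= h k.
  by move=> _; case: ifPn => // kn; exact: h.
by move=> kn; have := h k (ltnW kn : (k < n.+1)%N); rewrite kn.
Qed.

Lemma noise_past n (B : set R) : measurable B -> past n.+1 (z n @^-1` B).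
Proof.
move=> mB; exists (fun k => if k == n then B else setT).
  by move=> k; case: ifPn.
apply/seteqP; split => w /= h; last by have := h n (ltnSn n); rewrite eqxx.
by move=> k _; case: eqP => // ->.
Qed.

Variables (G : nat -> R -> R -> R) (y0 : R).
Hypothesis mG : forall n, measurable_fun setT (fun p : R * R => G n p.1 p.2).

Lemma driven_chain_past n (A : set R) : measurable A ->
  <<s past n >> (driven_chain G y0 n @^-1` A).
Proof.
elim: n A => [|n ih] A mA.
  have [h|h] := pselect (A y0).
    rewrite (_ : _ @^-1` _ = setT).
      exact: (@measurableT _ (g_sigma_algebraType (past 0))).
    by apply/seteqP; split.
  rewrite (_ : _ @^-1` _ = set0).
    exact: (@measurable0 _ (g_sigma_algebraType (past 0))).
  by apply/seteqP; split.
(* The recursion is read on the same space with the history as its sigma-algebra. *)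
pose T' := g_sigma_algebraType (past n.+1).
have mY : measurable_fun [set: T'] (driven_chain G y0 n : T' -> R).
  move=> _ B mB; rewrite setTI.
  by have := ih B mB; apply: sub_sigma_algebra2; exact: past_recS.
have mzn : measurable_fun [set: T'] (z n : T' -> R).
  move=> _ B mB; rewrite setTI; apply: sub_sigma_algebra; exact: noise_past.
have : measurable_fun [set: T'] (driven_chain G y0 n.+1 : T' -> R).
  exact: (measurableT_comp (mG n) (measurable_fun_pair mY mzn)).
by move=> /(_ measurableT A mA); rewrite setTI.
Qed.

Lemma measurable_driven_chain n : measurable_fun setT (driven_chain G y0 n).
Proof.
elim: n => [|n ih] /=; first exact: measurable_cst.
exact: (measurableT_comp (mG n) (measurable_fun_pair ih (mz n))).
Qed.

Local Open Scope ereal_scope.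

(** This replaces conditioning on the past: the chain at time [n] depends on earlier noise only, so
    its joint law with [z n] is a product measure and Tonelli's theorem applies. *)
Lemma driven_chain_fubini (n : nat) (Phi : (R * R)%type -> \bar R) :
  measurable_fun [set: (R * R)%type] Phi -> (forall p, 0 <= Phi p) ->
  \int[P]_w Phi (driven_chain G y0 n w, z n w) =
  \int[P]_w \int[P]_w' Phi (driven_chain G y0 n w, z n w').
Proof.
move=> mPhi Phi0; set Y := driven_chain G y0 n.
have mY : measurable_fun setT Y := measurable_driven_chain n.
have mYz : measurable_fun setT (fun w => (Y w, z n w)).
  exact: measurable_fun_pair.
pose Y' : {mfun T >-> R} := HB.pack Y (isMeasurableFun.Build _ _ _ _ _ mY).
pose z' : {mfun T >-> R} :=
  HB.pack (z n) (isMeasurableFun.Build _ _ _ _ _ (mz n)).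
pose Yz : {mfun T >-> (R * R)%type} :=
  HB.pack (fun w => (Y w, z n w)) (isMeasurableFun.Build _ _ _ _ _ mYz).
have -> : \int[P]_w Phi (Y w, z n w) = \int[distribution P Yz]_p Phi p.
  by rewrite ge0_integral_pushforward.
transitivity (\int[distribution P Y' \x distribution P z']_p Phi p).
  apply: eq_measure_integral => C mC _; apply/esym.
  apply: product_measure_unique => // A B mA mB.
  rewrite /distribution /pushforward -past_indep//.
  exact: driven_chain_past.
rewrite fubini_tonelli1// ge0_integral_pushforward//; last first.
- by move=> y _; exact: integral_ge0.
- exact: measurable_fun_fubini_tonelli_F.
apply: eq_integral => w _ /=.
rewrite /fubini_F ge0_integral_pushforward//.
by apply: measurableT_comp => //; exact: measurable_pair1.
Qed.

End driven_chain.

(** * Expectations under bounded centered noise *)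

Section centered_noise.
Context {disp : measure_display} {T : measurableType disp} {R : realType}.
Variables (P : probability T R) (xi : T -> R) (v : R).
Hypothesis mxi : measurable_fun setT xi.
Hypothesis xi1 : forall w, `|xi w| <= 1.
Hypothesis xi_mean : (\int[P]_w (xi w)%:E = 0)%E.
Hypothesis xi_var : (\int[P]_w (xi w ^+ 2)%:E = v%:E)%E.

Lemma bounded_integrable (f : T -> R) (K : R) : measurable_fun setT f ->
  (forall w, `|f w| <= K) -> P.-integrable setT (EFin \o f).
Proof.
move=> mf fK; apply: measurable_bounded_integrable => //.
  by rewrite ltey_eq fin_num_measure.
exists K; split; first exact: num_real.
by move=> x Kx w _; exact: le_trans (fK w) (ltW Kx).
Qed.

Lemma integral_probability_cst (r : R) : (\int[P]_w r%:E = r%:E)%E.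
Proof.
transitivity (\int[P]_w cst r%:E w)%E => //.
by rewrite integral_cst// [X in (_ * X)%E](@probability_setT _ _ _ P) mule1.
Qed.

Lemma integrable_noise : P.-integrable setT (EFin \o xi).
Proof. exact: bounded_integrable xi1. Qed.

Lemma integrable_noise2 : P.-integrable setT (EFin \o (fun w => xi w ^+ 2)).
Proof.
apply: (@bounded_integrable _ 1); first exact: measurable_funX.
by move=> w; rewrite normrX exprn_ile1.
Qed.

Lemma integrable_quadratic (A B D : R) :
  P.-integrable setT (EFin \o (fun w => A * xi w + B * xi w ^+ 2 + D)).
Proof.
apply: (@bounded_integrable _ (`|A| + `|B| + `|D|)).
  apply: measurable_funD; last exact: measurable_cst.
  apply: measurable_funD; apply: measurable_funM => //.
  exact: measurable_funX.
move=> w; apply: le_trans (ler_normD _ _) _; rewrite lerD2r.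
apply: le_trans (ler_normD _ _) _; rewrite !normrM.
by rewrite lerD//; apply: ler_piMr => //; rewrite mulr_ile1.
Qed.

Lemma integral_quadratic (A B D : R) :
  (\int[P]_w (A * xi w + B * xi w ^+ 2 + D)%:E = (B * v + D)%:E)%E.
Proof.
transitivity (\int[P]_w (A%:E * (xi w)%:E + B%:E * (xi w ^+ 2)%:E + D%:E))%E.
  by apply: eq_integral => w _; rewrite !EFinD !EFinM.
have i1 : P.-integrable setT (fun w => A%:E * (xi w)%:E)%E.
  exact: integrableZl integrable_noise.
have i2 : P.-integrable setT (fun w => B%:E * (xi w ^+ 2)%:E)%E.
  exact: integrableZl integrable_noise2.
have i3 : P.-integrable setT (fun _ => D%:E).
  exact: (@bounded_integrable (fun=> D) `|D|).
rewrite integralD//; last exact: integrableD.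
rewrite integralD// integralZl//; last exact: integrable_noise.
rewrite integralZl//; last exact: integrable_noise2.
by rewrite xi_mean xi_var mule0 add0e integral_probability_cst EFinD EFinM.
Qed.

(** The quadratic majorant is integrated: its linear term vanishes, and the square contributes
    [v]. *)
Lemma integral_quad_le (phi : R -> R) (g : R) :
  measurable_fun setT (phi \o xi) -> (forall z, `|z| <= 1 -> 0 <= phi z) ->
  quad_le v phi g -> (\int[P]_w (phi (xi w))%:E <= g%:E)%E.
Proof.
move=> mphi phi0 [A [B [D [h1 h2]]]].
apply: (@le_trans _ _ (B * v + D)%:E); last by rewrite lee_fin.
rewrite -(integral_quadratic A); apply: ge0_le_integral => //.
- by move=> w _; rewrite lee_fin phi0.
- exact/measurable_EFinP.
- by have /integrableP[] := integrable_quadratic A B D.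
- by move=> w _; rewrite lee_fin h1.
Qed.

(** The quadratic minorant may change sign, so integrals of integrable functions are compared; [K]
    makes [phi] integrable. *)
Lemma integral_quad_ge (phi : R -> R) (g K : R) :
  measurable_fun setT (phi \o xi) -> (forall z, `|z| <= 1 -> `|phi z| <= K) ->
  quad_le v (fun z => - phi z) (- g) -> (g%:E <= \int[P]_w (phi (xi w))%:E)%E.
Proof.
move=> mphi phi0 [A [B [D [h1 h2]]]].
apply: (@le_trans _ _ (- B * v + - D)%:E); first by rewrite lee_fin; lra.
rewrite -(integral_quadratic (- A)); apply: le_integral => //.
- exact: integrable_quadratic.
- by apply: (@bounded_integrable _ K) => // w; exact: phi0.
- by move=> w _; rewrite lee_fin; have := h1 _ (xi1 w); lra.
Qed.

End centered_noise.

(** * One-step drift in expectation *)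

Section driven_chain_drift.
Context {disp : measure_display} {T : measurableType disp} {R : realType}.
Variables (P : probability T R) (z : nat -> T -> R) (v : R).
Hypothesis mz : forall n, measurable_fun setT (z n).
Hypothesis indz : forall n (B : nat -> set R), (forall k, measurable (B k)) ->
  P (\bigcap_(k in `I_n) (z k @^-1` B k)) =
  (\prod_(k < n) P (z k @^-1` B k))%E.
Hypothesis z1 : forall n w, `|z n w| <= 1.
Hypothesis z_mean : forall n, (\int[P]_w (z n w)%:E = 0)%E.
Hypothesis z_var : forall n, (\int[P]_w (z n w ^+ 2)%:E = v%:E)%E.

Variables (G : nat -> R -> R -> R) (y0 : R).
Hypothesis mG : forall n, measurable_fun setT (fun p : R * R => G n p.1 p.2).

Let Y := driven_chain z G y0.

Let mY n : measurable_fun setT (Y n).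
Proof. exact: measurable_driven_chain. Qed.

Let meas_step n (f : R -> R) : measurable_fun setT f ->
  measurable_fun [set: (R * R)%type] (fun p => (f (G n p.1 p.2))%:E).
Proof. by move=> mf; apply/measurable_EFinP; exact: measurableT_comp. Qed.

Let meas_inner n (f : R -> R) : measurable_fun setT f -> (forall y, 0 <= f y) ->
  measurable_fun setT (fun w => (\int[P]_w' (f (G n (Y n w) (z n w')))%:E)%E).
Proof.
move=> mf f0.
pose Phi (p : (T * T)%type) : \bar R := (f (G n (Y n p.1) (z n p.2)))%:E.
apply: (@measurable_fun_fubini_tonelli_F _ _ _ _ _ P Phi).
- have h : measurable_fun [set: (T * T)%type] (fun p => (Y n p.1, z n p.2)).
    by apply: measurable_fun_pair; apply: measurableT_comp.
  exact: (measurableT_comp (meas_step n mf) h).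
- by move=> p; rewrite lee_fin.
Qed.

Let step_fubini n (f : R -> R) : measurable_fun setT f ->
  (forall y, 0 <= f y) ->
  (\int[P]_w (f (Y n.+1 w))%:E =
   \int[P]_w \int[P]_w' (f (G n (Y n w) (z n w')))%:E)%E.
Proof.
move=> mf f0.
apply: (@driven_chain_fubini _ _ _ P z mz indz G y0 mG n _ (meas_step n mf)).
by move=> p; rewrite lee_fin.
Qed.

(** After Tonelli the state is fixed in the inner integral, so the bound [quad_le] is needed only at
    states that the chain takes. *)
Lemma driven_chain_step_le n (f g : R -> R) : measurable_fun setT f ->
  measurable_fun setT g -> (forall y, 0 <= f y) ->
  (forall w, quad_le v (fun x => f (G n (Y n w) x)) (g (Y n w))) ->
  (\int[P]_w (f (Y n.+1 w))%:E <= \int[P]_w (g (Y n w))%:E)%E.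
Proof.
move=> mf mg f0 fg.
rewrite step_fubini//.
apply: ge0_le_integral => //.
- by move=> w _; apply: integral_ge0 => w' _; rewrite lee_fin.
- exact: meas_inner.
- by apply/measurable_EFinP; exact: measurableT_comp.
- move=> w _ /=; apply: (integral_quad_le (phi := fun x => f (G n (Y n w) x))
    (mz n) (z1 n) (z_mean n) (z_var n)) => //.
  apply: (measurableT_comp mf).
  have h : measurable_fun setT (fun w' => (Y n w, z n w')).
    exact: measurable_fun_pair.
  exact: (measurableT_comp (mG n) h).
Qed.

(** [K] may depend on the state, which is fixed in the inner integral. *)
Lemma driven_chain_step_ge n (f g K : R -> R) : measurable_fun setT f ->
  measurable_fun setT g -> (forall y, 0 <= f y) -> (forall w, 0 <= g (Y n w)) ->
  (forall w x, `|x| <= 1 -> `|f (G n (Y n w) x)| <= K (Y n w)) ->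
  (forall w, quad_le v (fun x => - f (G n (Y n w) x)) (- g (Y n w))) ->
  (\int[P]_w (g (Y n w))%:E <= \int[P]_w (f (Y n.+1 w))%:E)%E.
Proof.
move=> mf mg f0 g0 fK fg.
rewrite step_fubini//.
apply: ge0_le_integral => //.
- by move=> w _; rewrite lee_fin.
- by apply/measurable_EFinP; exact: measurableT_comp.
- exact: meas_inner.
- move=> w _ /=; apply: (integral_quad_ge (phi := fun x => f (G n (Y n w) x))
    (K := K (Y n w)) (mz n) (z1 n) (z_mean n) (z_var n)) => //.
    apply: (measurableT_comp mf).
    have h : measurable_fun setT (fun w' => (Y n w, z n w')).
    exact: measurable_fun_pair.
  exact: (measurableT_comp (mG n) h).
  exact: fK.
Qed.

End driven_chain_drift.

(** * Summable drifts *)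

Section summability.
Context {disp : measure_display} {T : measurableType disp} {R : realType}.
Variable P : probability T R.
Local Open Scope ereal_scope.

Lemma nonneg_ae_fin (f : T -> \bar R) : measurable_fun setT f ->
  (forall w, 0 <= f w) -> \int[P]_w f w < +oo -> {ae P, forall w, f w < +oo}.
Proof.
move=> mf f0 foo.
have : P.-integrable setT f.
  by apply/integrableP; split => //; under eq_integral do rewrite gee0_abs//.
move/(integrable_ae measurableT); apply: filterS => w /(_ I).
by rewrite fin_numE => /andP[_]; rewrite ltey.
Qed.

(** By monotone convergence the series has finite expectation; it is almost surely finite, and its
    terms tend to 0. *)
Lemma ae_cvg0_summable (u : nat -> T -> R) (K : R) :
  (forall n, measurable_fun setT (u n)) -> (forall n w, (0 <= u n w)%R) ->
  (forall n, \sum_(0 <= k < n) \int[P]_w (u k w)%:E <= K%:E) ->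
  {ae P, forall w, u n w @[n --> \oo] --> (0 : R)%R}.
Proof.
move=> mu u0 uK.
have muE n : measurable_fun setT (fun w => (u n w)%:E).
  exact/measurable_EFinP.
pose S w := \sum_(n <oo) (u n w)%:E.
have : {ae P, forall w, S w < +oo}.
  apply: nonneg_ae_fin.
  - by apply: ge0_emeasurable_sum => // k w _ _; rewrite lee_fin.
  - by move=> w; apply: nneseries_ge0 => n _ _; rewrite lee_fin.
  - rewrite integral_nneseries//; last by move=> n w _; rewrite lee_fin.
    apply: (@le_lt_trans _ _ K%:E); last by rewrite ltry.
    apply: lime_le.
      apply: is_cvg_nneseries => n _ _.
      by apply: integral_ge0 => w _; rewrite lee_fin.
    by apply: nearW => n; exact: uK.
apply: filterS => w Sw.
have tail0 := nneseries_tail_cvg Sw (fun k _ => u0 k w : 0 <= (u k w)%:E).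
suff : (u n w)%:E @[n --> \oo] --> 0 by move/fine_cvg.
apply: squeeze_cvge (cvg_cst 0) tail0; apply: nearW => n.
rewrite lee_fin u0/=.
have := @nneseries_lim_ge R (fun k => (u k w)%:E) xpredT n n.+1.
by rewrite big_nat1; apply => k _ _; rewrite lee_fin.
Qed.

(** Telescoping; integrability keeps the integrals finite, so that they can be subtracted in the
    extended reals. *)
Lemma drift_sum_le (F U : nat -> T -> R) :
  (forall n, P.-integrable setT (EFin \o F n)) ->
  (forall n, P.-integrable setT (EFin \o U n)) ->
  (forall n, \int[P]_w (F n.+1 w)%:E <= \int[P]_w (F n w - U n w)%:E) ->
  forall n, \int[P]_w (F n w)%:E + \sum_(0 <= k < n) \int[P]_w (U k w)%:E <=
    \int[P]_w (F 0%N w)%:E.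
Proof.
move=> iF iU FU; elim=> [|n ih]; first by rewrite big_nil adde0.
rewrite big_nat_recr//=; apply: le_trans ih.
rewrite [X in _ + X <= _]addeC addeA leeD2r//.
have fU := integrable_fin_num measurableT (iU n).
rewrite -leeBrDr//.
have -> // : \int[P]_w (F n w)%:E - \int[P]_w (U n w)%:E =
  \int[P]_w (F n w - U n w)%:E.
by under [RHS]eq_integral do rewrite EFinB; rewrite integralB_EFin.
Qed.

(** Telescoping by additions only, so nonnegativity takes the place of integrability. *)
Lemma drift_sum_ge (F U : nat -> T -> R) :
  (forall n, measurable_fun setT (F n)) -> (forall n w, (0 <= F n w)%R) ->
  (forall n, measurable_fun setT (U n)) -> (forall n w, (0 <= U n w)%R) ->
  (forall n, \int[P]_w (F n w + U n w)%:E <= \int[P]_w (F n.+1 w)%:E) ->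
  forall n, \sum_(0 <= k < n) \int[P]_w (U k w)%:E <= \int[P]_w (F n w)%:E.
Proof.
move=> mF F0 mU U0 FU; elim=> [|n ih].
  by rewrite big_nil; apply: integral_ge0 => w _; rewrite lee_fin.
rewrite big_nat_recr//=; apply: le_trans (FU n).
under [leRHS]eq_integral do rewrite EFinD.
rewrite ge0_integralD//; first by rewrite leeD2r.
- by move=> w _; rewrite lee_fin.
- exact/measurable_EFinP.
- by move=> w _; rewrite lee_fin.
- exact/measurable_EFinP.
Qed.

End summability.

Lemma cvgy_of_inv_cube {R : realType} (kap c : R) (y : nat -> R) : 0 < kap ->
  (forall n, 0 < c + y n) -> kap / (c + y n) ^+ 3 @[n --> \oo] --> (0 : R) ->
  y n @[n --> \oo] --> +oo.
Proof.
move=> k0 y0 h; apply/cvgryPge => M.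
(* The value of the drift term at [c + y = |c| + |M| + 1]; a smaller term forces [y > M]. *)
pose e := kap / (`|c| + `|M| + 1) ^+ 3.
have p0 : 0 < `|c| + `|M| + 1 by rewrite ltr_wpDl// addr_ge0.
have e0 : 0 < e by rewrite divr_gt0 ?exprn_gt0.
have /cvgrPdist_lt/(_ e e0) := h.
apply: filterS => n; rewrite sub0r normrN gtr0_norm; last first.
  by rewrite divr_gt0 ?exprn_gt0.
rewrite ltr_pM2l// ltf_pV2 ?posrE ?exprn_gt0//.
rewrite ltr_pXn2r// ?nnegrE ?(ltW p0) ?(ltW (y0 n))//.
by move=> hn; have := ler_norm c; have := ler_norm M; lra.
Qed.

Lemma limn_einf_le_frequently {R : realType} (u : (\bar R)^nat) (K : \bar R) :
  (forall N, exists2 n, (N <= n)%N & (u n <= K)%E) -> (limn_einf u <= K)%E.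
Proof.
move=> uK; rewrite limn_einf_lim; apply: lime_le; first exact: is_cvg_einfs.
apply: nearW => n; have [m nm umK] := uK n.
by apply: le_trans umK; apply: ereal_inf_lbound; exists m.
Qed.

(** * The squared radius *)

Lemma measurable_sqrt {R : realType} : measurable_fun setT (@Num.sqrt R).
Proof. by apply: continuous_measurable_fun; exact: sqrt_continuous. Qed.

(** On nonnegative reals inversion is the real power of exponent -1, also at 0, where both are 0 by
    convention. *)
Lemma measurable_funV {R : realType} d (T : measurableType d) (f : T -> R) :
  measurable_fun setT f -> (forall w, 0 <= f w) ->
  measurable_fun setT (fun w => (f w)^-1).
Proof.
move=> mf f0; rewrite (_ : (fun _ => _) = (fun x => x `^ -1) \o f).
  exact: measurableT_comp.
by apply/funext => w /=; rewrite powR_inv1.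
Qed.

Lemma measurable_radial_step {R : realType} (al be : R) :
  measurable_fun setT (fun p : R * R => radial_step al be p.1 p.2).
Proof.
have msq : measurable_fun setT (fun p : R * R => Num.sqrt p.1).
  by apply: measurableT_comp => //; exact: measurable_sqrt.
rewrite /radial_step; apply: measurable_funD; last first.
  apply: measurable_funM => //; exact: measurable_funX.
apply: measurable_funD => //; apply: measurable_funD => //.
by apply: measurable_funM => //; apply: measurable_funM.
Qed.

Section radial_chain.
Context {disp : measure_display} {T : measurableType disp} {R : realType}.
Variables (P : probability T R) (z : nat -> T -> R) (v : R).
Hypothesis mz : forall n, measurable_fun setT (z n).
Hypothesis indz : forall n (B : nat -> set R), (forall k, measurable (B k)) ->
  P (\bigcap_(k in `I_n) (z k @^-1` B k)) =
  (\prod_(k < n) P (z k @^-1` B k))%E.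
Hypothesis z1 : forall n w, `|z n w| <= 1.
Hypothesis z_mean : forall n, (\int[P]_w (z n w)%:E = 0)%E.
Hypothesis z_var : forall n, (\int[P]_w (z n w ^+ 2)%:E = v%:E)%E.
Variables (al be s0 : R).
Hypotheses (al0 : 0 < al) (be0 : 0 < be) (v0 : 0 < v) (v1 : v < 1).
Hypothesis s00 : 0 <= s0.

Let S := driven_chain z (fun=> radial_step al be) s0.

Lemma radial_chain_ge0 n w : 0 <= S n w.
Proof. by elim: n => [//|n ih] /=; exact: radial_step_ge0. Qed.

Lemma measurable_radial_chain n : measurable_fun setT (S n).
Proof.
by apply: measurable_driven_chain => // k; exact: measurable_radial_step.
Qed.

Lemma radial_step_le (M s x : R) : 0 <= s <= M -> `|x| <= 1 ->
  radial_step al be s x <= M + 2 * al * Num.sqrt M + (al ^+ 2 + be ^+ 2).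
Proof.
move=> /andP[s0' sM] x1; rewrite /radial_step -addrA lerD//; last first.
  by have /andP[] := @quadratic_part_bounds R al be x x1.
rewrite lerD// -[leRHS]mulr1.
apply: le_trans (ler_wpM2l _ (le_trans (ler_norm x) x1)) _.
  by rewrite mulr_ge0 ?sqrtr_ge0// mulr_ge0// ltW.
by rewrite !mulr1 ler_pM2l ?mulr_gt0// ler_wsqrtr.
Qed.

Lemma radial_chain_transient : al ^+ 2 * v < be ^+ 2 * (1 - v) ->
  {ae P, forall w, S n w @[n --> \oo] --> +oo}.
Proof.
move=> /(transient_drift al0 be0 (ltW v0))[c [eta [c2 eta0 drift]]].
(* The absolute value changes nothing on the chain and makes [f] and [u] nonnegative and bounded on
   the whole line. *)
pose f (y : R) := (ln (c + `|y|))^-1.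
pose u (y : R) := eta / (c + `|y|) ^+ 3.
have cy (y : R) : 2 <= c + `|y| by rewrite (le_trans c2)// lerDl.
have ln2 : 0 < ln (2 : R) by rewrite ln_gt0// ltr1n.
have lny (y : R) : ln 2 <= ln (c + `|y|).
  by rewrite ler_ln ?posrE//; have := cy y; lra.
have f0 y : 0 <= f y by rewrite invr_ge0 (le_trans (ltW ln2)).
have u0 y : 0 <= u y by rewrite divr_ge0 ?ltW// exprn_gt0//; have := cy y; lra.
have mcy : measurable_fun setT (fun y : R => c + `|y|).
  by apply: measurable_funD => //; exact: normr_measurable.
have mf : measurable_fun setT f.
  apply: measurable_funV => [|w]; last by rewrite (le_trans (ltW ln2)).
  by apply: measurableT_comp => //; exact: measurable_ln.
have mu : measurable_fun setT u.
  apply: measurable_funM => //; apply: measurable_funV => [|w].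
    exact: measurable_funX.
  by rewrite exprn_ge0//; have := cy w; lra.
have mS := measurable_radial_chain.
have iF n : P.-integrable setT (EFin \o (f \o S n)).
  apply: (@bounded_integrable _ _ _ _ _ (ln 2)^-1).
    exact: measurableT_comp.
  move=> w; rewrite ger0_norm ?f0// /f lef_pV2 ?posrE//.
  exact: lt_le_trans (lny _).
have iU n : P.-integrable setT (EFin \o (u \o S n)).
  apply: (@bounded_integrable _ _ _ _ _ eta).
    exact: measurableT_comp.
  move=> w; rewrite ger0_norm ?u0// /u ler_pdivrMr; last first.
    by rewrite exprn_gt0//; have := cy (S n w); lra.
  rewrite ler_peMr ?(ltW eta0)// exprn_ege1//; have := cy (S n w); lra.
have FU n : (\int[P]_w ((f \o S n.+1) w)%:E <=
             \int[P]_w ((f \o S n) w - (u \o S n) w)%:E)%E.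
  apply: (@driven_chain_step_le _ _ _ P z v mz indz z1 z_mean z_var
    (fun=> radial_step al be) s0 _ n f (fun y => f y - u y)) => //.
  - by move=> k; exact: measurable_radial_step.
  - exact: measurable_funB.
  - move=> w; have := drift _ (radial_chain_ge0 n w).
    rewrite /f /u (ger0_norm (radial_chain_ge0 n w)).
    apply: eq_quad_le => x x1.
    by rewrite ger0_norm// radial_step_ge0// radial_chain_ge0.
have sum := drift_sum_le iF iU FU.
have fin := integrable_fin_num measurableT (iF 0%N).
have : {ae P, forall w, (u \o S n) w @[n --> \oo] --> 0}.
  apply: (@ae_cvg0_summable _ _ _ _ (fun n => u \o S n)
    (fine (\int[P]_w ((f \o S 0%N) w)%:E)%E)).
  - by move=> n; exact: measurableT_comp.
  - by move=> n w; exact: u0.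
  - move=> n; rewrite fineK//; apply: le_trans (sum n).
    by apply: leeDr; apply: integral_ge0 => w _; rewrite lee_fin f0.
apply: filterS => w; rewrite /u /= => h.
apply: (cvgy_of_inv_cube (c := c) eta0).
  move=> n; have := cy (S n w).
  by have := radial_chain_ge0 n w => /ger0_norm ->; lra.
apply: cvg_trans h; apply: near_eq_cvg; apply: nearW => n /=.
by rewrite ger0_norm// radial_chain_ge0.
Qed.

Lemma radial_chain_occupation (M : R) : exists2 C, 0 <= C &
  forall n, (\sum_(0 <= k < n) \int[P]_w ((S k w <= M)%R%:R)%:E <=
             (C * Num.sqrt n%:R)%:E)%E.
Proof.
have [c [eta [c1 eta0 drift]]] := null_drift al0 be0 (ltW v0) v1.
pose f (y : R) := Num.sqrt (c + `|y|).
pose u (y : R) := eta / f y.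
(* The mean increment of the squared radius in one step. *)
pose m := be ^+ 2 + (al ^+ 2 - be ^+ 2) * v.
have mS := measurable_radial_chain.
have mcy : measurable_fun setT (fun y : R => c + `|y|).
  by apply: measurable_funD => //; exact: normr_measurable.
have mf : measurable_fun setT f.
  by apply: measurableT_comp => //; exact: measurable_sqrt.
have f0 y : 0 <= f y by exact: sqrtr_ge0.
have fy0 y : 0 < f y by rewrite sqrtr_gt0 ltr_wpDr//; lra.
have mu : measurable_fun setT u.
  by apply: measurable_funM => //; apply: measurable_funV.
have u0 y : 0 <= u y by rewrite divr_ge0// ltW.
have FU n : (\int[P]_w ((f \o S n) w + (u \o S n) w)%:E <=
             \int[P]_w ((f \o S n.+1) w)%:E)%E.
  apply: (@driven_chain_step_ge _ _ _ P z v mz indz z1 z_mean z_var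
    (fun=> radial_step al be) s0 _ n f (fun y => f y + u y)
    (fun y => f (y + 2 * al * Num.sqrt y + (al ^+ 2 + be ^+ 2)))) => //.
  - by move=> k; exact: measurable_radial_step.
  - exact: measurable_funD.
  - by move=> w; rewrite addr_ge0.
  - move=> w x x1; rewrite ger0_norm// /f ler_wsqrtr// lerD2l.
    have s := radial_chain_ge0 n w; rewrite -/S.
    rewrite ger0_norm ?radial_step_ge0//; apply: le_trans (ler_norm _).
    by apply: radial_step_le; rewrite ?s ?lexx.
  - move=> w; have := drift _ (radial_chain_ge0 n w).
    rewrite /u /f (ger0_norm (radial_chain_ge0 n w)).
    apply: eq_quad_le => x x1.
    by rewrite ger0_norm// radial_step_ge0// radial_chain_ge0.
have sum n : (\sum_(0 <= k < n) \int[P]_w ((u \o S k) w)%:E <=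
    \int[P]_w ((f \o S n) w)%:E)%E.
  apply: (drift_sum_ge (F := fun n => f \o S n) (U := fun n => u \o S n)).
  - by move=> k; exact: measurableT_comp.
  - by move=> k w; exact: f0.
  - by move=> k; exact: measurableT_comp.
  - by move=> k w; exact: u0.
  - exact: FU.
have m0 : 0 <= m.
  rewrite /m; have := mulr_ge0 (sqr_ge0 al) (ltW v0).
  have : 0 <= be ^+ 2 * (1 - v).
    by apply: mulr_ge0; [exact: sqr_ge0|rewrite subr_ge0 ltW].
  lra.
have mSabs n : measurable_fun setT (fun w => (`|S n w|)%:E).
  by apply/measurable_EFinP; apply: measurableT_comp.
have ES n : (\int[P]_w (`|S n w|)%:E <= (s0 + m * n%:R)%:E)%E.
  elim: n => [|n ih].
    rewrite mulr0 addr0 -[leRHS](integral_probability_cst P) le_eqVlt.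
    by apply/orP; left; apply/eqP/eq_integral => w _; rewrite /S/= ger0_norm.
  apply: (@le_trans _ _ (\int[P]_w (`|S n w| + m)%:E)%E).
    apply: (@driven_chain_step_le _ _ _ P z v mz indz z1 z_mean z_var
      (fun=> radial_step al be) s0 _ n (fun y => `|y|)
      (fun y => `|y| + m)) => //.
    - by move=> k; exact: measurable_radial_step.
    - by apply: measurable_funD => //; exact: normr_measurable.
    - move=> w; have s := radial_chain_ge0 n w.
      rewrite -/S; move: s; set y := S n w => s.
      exists (2 * al * Num.sqrt y), (al ^+ 2 - be ^+ 2), (y + be ^+ 2).
      split=> [x x1|]; last by rewrite (ger0_norm s) /m; lra.
      by rewrite ger0_norm ?radial_step_ge0// /radial_step; lra.
  under eq_integral do rewrite EFinD.
  rewrite ge0_integralD//; [|exact: mSabs..].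
  rewrite integral_probability_cst.
  rewrite -natr1 mulrDr mulr1 addrA [leRHS]EFinD; exact: leeD2r.
clearbody m.
have Ef n : (0 < n)%N -> (\int[P]_w ((f \o S n) w)%:E <=
    ((s0 + c + m + 1) / 2 * Num.sqrt n%:R)%:E)%E.
  move=> n0; set l := Num.sqrt _.
  have l1 : 1 <= l by rewrite -sqrtr1 ler_wsqrtr// ler1n.
  have l0 : 0 < l by lra.
  have lE : n%:R = l ^+ 2 by rewrite sqr_sqrtr.
  (* Tangent line of the square root at [n = l ^+ 2]: [Num.sqrt x <= i * x + l / 2], which reduces
     the bound to the linear growth of the mean of [S n]. *)
  pose i := (2 * l)^-1; have i0 : 0 < i by rewrite invr_gt0 mulr_gt0.
  have il : i * l = 2^-1 by rewrite /i; field; lra.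
  apply: (@le_trans _ _ (\int[P]_w (i * `|S n w| + (c * i + l / 2))%:E)%E).
    apply: ge0_le_integral => //.
    - by move=> w _; rewrite lee_fin; exact: f0.
    - by apply/measurable_EFinP; exact: measurableT_comp.
    - apply/measurable_EFinP; apply: measurable_funD => //.
      by apply: measurable_funM => //; apply: measurableT_comp.
    - move=> w _; rewrite lee_fin /=.
      have cS : 0 <= c + `|S n w| by rewrite addr_ge0//; lra.
      have fE : f (S n w) ^+ 2 = c + `|S n w| by rewrite sqr_sqrtr.
      have := mulr_ge0 (ltW i0) (sqr_ge0 (f (S n w) - l)).
      have -> : i * (f (S n w) - l) ^+ 2 = i * f (S n w) ^+ 2 -
         2 * (i * l) * f (S n w) + (i * l) * l by ring.
      by rewrite fE il; lra.
  have -> : (\int[P]_w (i * `|S n w| + (c * i + l / 2))%:E =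
      i%:E * \int[P]_w (`|S n w|)%:E + (c * i + l / 2)%:E)%E.
    have h1 w : (0 <= (i * `|S n w|)%:E)%E by rewrite lee_fin mulr_ge0// ltW.
    have h2 : measurable_fun setT (fun w => (i * `|S n w|)%:E).
      apply/measurable_EFinP; apply: measurable_funM => //.
      by apply: measurableT_comp => //; exact: normr_measurable.
    have h3 : (0 <= (c * i + l / 2)%:E)%E.
      by rewrite lee_fin addr_ge0// ?mulr_ge0//; lra.
    under eq_integral do rewrite EFinD.
    rewrite (ge0_integralD _ measurableT (fun w _ => h1 w) h2 (fun _ _ => h3)
      (measurable_cst _)).
    rewrite integral_probability_cst; congr (_ + _)%E.
    under eq_integral do rewrite EFinM.
    rewrite ge0_integralZl_EFin//; last by rewrite ltW.
  apply: (@le_trans _ _ (i%:E * (s0 + m * n%:R)%:E + (c * i + l / 2)%:E)%E).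
    by rewrite leeD2r// lee_wpmul2l// lee_fin ltW.
  rewrite -EFinM -EFinD lee_fin lE.
  have -> : i * (s0 + m * l ^+ 2) = s0 * i + m * (i * l) * l by ring.
  rewrite il.
  have ll : i <= l / 2.
    rewrite /i invfM mulrC ler_pM2r ?invr_gt0//.
    by rewrite (le_trans _ l1)// invf_le1.
  have := ler_wpM2l s00 ll; have := ler_wpM2l (le_trans ler01 c1) ll.
  lra.
(* With this [K], [K * u y >= 1] whenever [0 <= y <= M]: visits are dominated by drift terms. *)
pose K := Num.sqrt (c + `|M|) / eta.
have K0 : 0 <= K by rewrite divr_ge0// ltW.
exists (K * ((s0 + c + m + 1) / 2)).
  apply: mulr_ge0 => //; apply: divr_ge0 => //.
  by have h := le_trans ler01 c1; rewrite !addr_ge0.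
case=> [|n]; first by rewrite big_nil sqrtr0 mulr0.
apply: (@le_trans _ _
  (\sum_(0 <= k < n.+1) K%:E * \int[P]_w ((u \o S k) w)%:E)%E).
  apply: lee_sum => k _.
  rewrite -ge0_integralZl_EFin//; [|by move=> w _; exact: u0|]; last first.
    by apply/measurable_EFinP; exact: measurableT_comp.
  apply: ge0_le_integral => //.
  - apply/measurable_EFinP.
    rewrite (_ : (fun _ => _) = (fun w => if S k w <= M then 1 else 0)).
      by apply: measurable_fun_ifT => //; exact: measurable_fun_ler.
    by apply/funext => w; case: ifP.
  - apply/measurable_EFinP; apply: measurable_funM => //.
    exact: measurableT_comp.
  - move=> w _; rewrite -EFinM lee_fin; case: (leP (S k w) M) => SM; last first.
      by rewrite mulr_ge0//; exact: u0.
    rewrite /= /K /u mulrA mulrVK ?unitfE ?gt_eqF// ler_pdivlMr// mul1r.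
    rewrite /f ler_wsqrtr// lerD2l (ger0_norm (radial_chain_ge0 _ _)).
    exact: le_trans SM (ler_norm _).
rewrite -ge0_sume_distrr; last first.
  by move=> k _; apply: integral_ge0 => w _; rewrite lee_fin; exact: u0.
rewrite -mulrA [leRHS]EFinM; apply: lee_wpmul2l; first by rewrite lee_fin.
exact: le_trans (sum n.+1) (Ef n.+1 _).
Qed.

(* The walk frozen at its first visit to [[0, r]] after time [N]. *)
Definition stopped_step (N : nat) (r : R) (k : nat) (y x : R) : R :=
  if (N <= k)%N && (y <= r) then y else radial_step al be y x.

Lemma measurable_stopped_step N r k :
  measurable_fun setT (fun p : R * R => stopped_step N r k p.1 p.2).
Proof.
rewrite /stopped_step; case: (leqP N k) => _ /=; last first.
  exact: measurable_radial_step.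
apply: measurable_fun_ifT => //; last exact: measurable_radial_step.
exact: measurable_fun_ler.
Qed.

Lemma stopped_chain_ge0 N r n w :
  0 <= driven_chain z (stopped_step N r) s0 n w.
Proof.
elim: n => [//|n ih] /=; rewrite /stopped_step; case: ifP => // _.
exact: radial_step_ge0.
Qed.

(** Bounded noise keeps the chain in a bounded range at each fixed time, which makes its Lyapunov
    function integrable. *)
Lemma stopped_chain_bounded N r n :
  exists M, forall w, driven_chain z (stopped_step N r) s0 n w <= M.
Proof.
elim: n => [|n [M ih]]; first by exists s0.
pose M' := M + 2 * al * Num.sqrt M + (al ^+ 2 + be ^+ 2).
exists (Num.max M M') => w /=; rewrite /stopped_step le_max.
case: ifP => _; first by rewrite ih.
rewrite radial_step_le ?orbT// stopped_chain_ge0; exact: ih.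
Qed.

Lemma stopped_chainE N r w : (forall n, (N <= n)%N -> r < S n w) ->
  forall n, driven_chain z (stopped_step N r) s0 n w = S n w.
Proof.
move=> h; elim=> [//|n ih] /=; rewrite /stopped_step ih.
by case: ifP => // /andP[Nn]; rewrite leNgt h.
Qed.

Lemma radial_chain_recurrent : be ^+ 2 * (1 - v) <= al ^+ 2 * v ->
  exists2 r : R, 0 <= r & forall N,
    {ae P, forall w, exists2 n, (N <= n)%N & S n w <= r}.
Proof.
move=> /(recurrent_drift al0 be0 v0)[r [kap [r2 kap0 drift]]].
exists r; first lra.
(* Time is counted from [N], so that the freezing rule is in force at every step of [Y]. *)
move=> N; pose Y n := driven_chain z (stopped_step N r) s0 (N + n).
have Y0 n w : 0 <= Y n w by exact: stopped_chain_ge0.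
pose f (y : R) := Num.sqrt (ln y).
(* The drift term is 0 where the chain is frozen. *)
pose u (y : R) := if y <= r then 0 else kap / (`|y|) ^+ 3.
have f0 y : 0 <= f y by exact: sqrtr_ge0.
have u0 y : 0 <= u y.
  by rewrite /u; case: ifP => // _; rewrite divr_ge0 ?exprn_ge0// ltW.
have uk y : u y <= kap.
  rewrite /u; case: ifP => [_|/negbT]; first exact: ltW.
  rewrite -ltNge => ry.
  have y1 : 1 <= `|y| by rewrite (le_trans _ (ler_norm y))//; lra.
  rewrite ler_pdivrMr ?exprn_gt0 ?(lt_le_trans ltr01)//.
  by rewrite ler_peMr ?(ltW kap0)// exprn_ege1.
have mf : measurable_fun setT f.
  apply: measurableT_comp; [exact: measurable_sqrt|exact: measurable_ln].
have mu : measurable_fun setT u.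
  apply: measurable_fun_ifT => //; first exact: measurable_fun_ler.
  apply: measurable_funM => //; apply: measurable_funV => [|w].
    by apply: measurable_funX; exact: normr_measurable.
  by rewrite exprn_ge0.
have mY n : measurable_fun setT (Y n).
  by apply: measurable_driven_chain => // k; exact: measurable_stopped_step.
have mfY n : measurable_fun setT (f \o Y n) by exact: measurableT_comp.
have iF n : P.-integrable setT (EFin \o (f \o Y n)).
  have [M hM] := stopped_chain_bounded N r (N + n).
  apply: (@bounded_integrable _ _ _ _ _ (1 + M)) => // w.
  rewrite ger0_norm ?f0//; apply: le_trans (sqrt_ln_le (Y0 n w)) _.
  by rewrite lerD2l; exact: hM.
have iU n : P.-integrable setT (EFin \o (u \o Y n)).
  apply: (@bounded_integrable _ _ _ _ _ kap); first exact: measurableT_comp.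
  by move=> w; rewrite ger0_norm ?u0 ?uk.
have FU n : (\int[P]_w ((f \o Y n.+1) w)%:E <=
             \int[P]_w ((f \o Y n) w - (u \o Y n) w)%:E)%E.
  rewrite /Y addnS.
  apply: (@driven_chain_step_le _ _ _ P z v mz indz z1 z_mean z_var
    (stopped_step N r) s0 _ (N + n) f (fun y => f y - u y)) => //.
  - by move=> k; exact: measurable_stopped_step.
  - exact: measurable_funB.
  - move=> w; rewrite -/(Y n); move: (Y0 n w); set y := Y n w => y0.
    rewrite /stopped_step leq_addr /= /u; case: (leP y r) => yr.
      by exists 0, 0, (f y); split=> [x _|]; lra.
    by rewrite (ger0_norm y0); exact: drift _ (ltW yr).
have sum := drift_sum_le iF iU FU.
have fin := integrable_fin_num measurableT (iF 0%N).
have u_cvg : {ae P, forall w, (u \o Y n) w @[n --> \oo] --> 0}.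
  apply: (@ae_cvg0_summable _ _ _ _ (fun n => u \o Y n)
    (fine (\int[P]_w ((f \o Y 0%N) w)%:E)%E)).
  - by move=> n; exact: measurableT_comp.
  - by move=> n w; exact: u0.
  - move=> n; rewrite fineK//; apply: le_trans (sum n).
    by apply: leeDr; apply: integral_ge0 => w _; rewrite lee_fin f0.
have f_liminf :
    {ae P, forall w, (limn_einf (fun n => ((f \o Y n) w)%:E) < +oo)%E}.
  apply: nonneg_ae_fin.
  - rewrite /limn_einf; apply: measurableT_comp => //.
    apply: measurable_fun_limn_esup => n.
    by apply: measurableT_comp => //; apply/measurable_EFinP.
  - move=> w; rewrite limn_einf_lim; apply: lime_ge; first exact: is_cvg_einfs.
    apply: nearW => n; apply: le_ereal_inf_tmp => _ [m _ <-].
    by rewrite lee_fin; exact: f0.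
  (* Fatou's lemma; by the drift inequality all expectations are at most the initial one. *)
  - apply: (@le_lt_trans _ _ (\int[P]_w ((f \o Y 0%N) w)%:E)%E); last first.
      by rewrite ltey_eq fin.
    apply: le_trans (fatou P measurableT _ _) _ => [n|n w _|].
    + by apply/measurable_EFinP.
    + by rewrite lee_fin; exact: f0.
    + apply: limn_einf_le_frequently => M; exists M => //.
      apply: le_trans (sum M); apply: leeDl; apply: sume_ge0 => k _.
      by apply: integral_ge0 => w _; rewrite lee_fin; exact: u0.
apply: filterS2 u_cvg f_liminf => w /= uw fw.
(* Without a visit after time [N] nothing is frozen: vanishing drift terms send the chain to
   infinity, against the finite lower limit of [f]. *)
apply: contrapT => noret.
have Sr n : (N <= n)%N -> r < S n w.
  by move=> Nn; rewrite ltNge; apply/negP => Sn; apply: noret; exists n.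
have YS n : Y n w = S (N + n)%N w by rewrite /Y (stopped_chainE Sr).
have Yr n : r < Y n w by rewrite YS Sr// leq_addr.
have Yy : Y n w @[n --> \oo] --> +oo.
  apply: (cvgy_of_inv_cube (c := 0) kap0).
    by move=> n; rewrite add0r; have := Yr n; lra.
  apply: cvg_trans uw; apply: near_eq_cvg; apply: nearW => n /=.
  by rewrite /u leNgt (Yr n)/= add0r ger0_norm.
have fy : ((f \o Y n) w)%:E @[n --> \oo] --> +oo%E.
  apply/cvgeryP/cvgryPge => A.
  have /cvgryPge/(_ (expR (A ^+ 2))) := Yy.
  apply: filterS => n An; apply: le_trans (ler_norm A) _.
  rewrite -sqrtr_sqr /f /=; apply: ler_wsqrtr.
  rewrite -[leLHS]expRK ler_ln ?posrE ?expR_gt0//.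
  by have := Yr n; lra.
by move: fw; rewrite (cvg_limn_einf_sup fy).1 ltxx.
Qed.

End radial_chain.

(** * Uniform vectors on the sphere *)

Section geometry.
Context {R : realType} {d : nat}.
Implicit Types (x y u : 'cV[R]_d.+1).

Lemma enorm_ge0 x : 0 <= enorm x.
Proof. exact: sqrtr_ge0. Qed.

Lemma sqr_enorm x : enorm x ^+ 2 = \sum_(i < d.+1) x i 0 ^+ 2.
Proof. by rewrite sqr_sqrtr// sumr_ge0// => i _; exact: sqr_ge0. Qed.

Lemma sqr_enormE x : enorm x ^+ 2 = (x^T *m x) 0 0.
Proof.
by rewrite sqr_enorm mxE; apply: eq_bigr => i _; rewrite mxE expr2.
Qed.

Lemma enorm_eq0 x : (enorm x == 0) = (x == 0).
Proof.
apply/eqP/eqP => [x0|->]; last first.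
  by rewrite /enorm big1 ?sqrtr0// => i _; rewrite mxE expr0n.
have := sqr_enorm x; rewrite x0 expr0n /= => /esym/eqP.
rewrite psumr_eq0 => [/allP h|i _]; last exact: sqr_ge0.
apply/matrixP => i j; rewrite ord1 mxE; apply/eqP.
by have := h i (mem_index_enum i); rewrite sqrf_eq0.
Qed.

Lemma enorm_hat x : usphere (hat x).
Proof.
have h u r : 0 <= r -> enorm u ^+ 2 = r ^+ 2 -> enorm u = r.
  by move=> r0 /eqP; rewrite eqrXn2 ?enorm_ge0// => /eqP.
rewrite /usphere /= /hat; case: eqVneq => x0; apply: h => //; rewrite sqr_enorm.
  rewrite big_ord_recl big1 ?addr0 => [|i _]; rewrite mxE /= ?expr0n//.
have n0 : enorm x != 0 by rewrite enorm_eq0.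
under eq_bigr do rewrite mxE exprMn.
by rewrite -mulr_sumr -sqr_enorm -exprMn mulVf.
Qed.

Lemma enorm_scale_hat x : x = enorm x *: hat x.
Proof.
rewrite /hat; case: eqVneq => [->|x0].
  by rewrite (eqP (_ : enorm 0 == 0)) ?enorm_eq0// scale0r.
by rewrite scalerA divff ?scale1r// enorm_eq0.
Qed.

Lemma enorm_orthogonal (U : 'M[R]_d.+1) x : orthogonal_mx U ->
  enorm (U *m x) ^+ 2 = enorm x ^+ 2.
Proof.
by move=> oU; rewrite !sqr_enormE trmx_mul mulmxA -(mulmxA x^T) oU mulmx1.
Qed.

(** Factoring out the isometry [Q] leaves the norm of [|x| e1 + D zeta]; the coordinates of [zeta]
    other than the first share the factor [b] and enter only through their sum of squares. *)
Lemma sqr_enorm_step (Q : 'M[R]_d.+1) (a b : R) x zeta : orthogonal_mx Q ->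
  Q *m e1 R d.+1 = hat x -> enorm zeta = 1 ->
  enorm (x + Q *m elliptic_mx d.+1 a b *m zeta) ^+ 2 =
  radial_step (Num.sqrt d.+1%:R * a) (Num.sqrt d.+1%:R * b) (enorm x ^+ 2)
    (zeta 0 0).
Proof.
move=> oQ Qe z1; set q := Num.sqrt _.
have -> : x + Q *m elliptic_mx d.+1 a b *m zeta =
    Q *m (enorm x *: e1 R d.+1 + elliptic_mx d.+1 a b *m zeta).
  have Qx : Q *m (enorm x *: e1 R d.+1) = x.
    by rewrite -scalemxAr Qe -enorm_scale_hat.
  by rewrite mulmxDr mulmxA Qx.
rewrite (enorm_orthogonal _ oQ) [LHS]sqr_enorm.
have zE : \sum_(i < d) zeta (lift ord0 i) 0 ^+ 2 = 1 - zeta 0 0 ^+ 2.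
  have := sqr_enorm zeta; rewrite z1 expr1n big_ord_recl => ->.
  by rewrite addrAC subrr add0r.
have cE i : (enorm x *: e1 R d.+1 + elliptic_mx d.+1 a b *m zeta) i 0 =
    enorm x * (i == 0%N :> nat)%:R +
    q * ((if i == 0%N :> nat then a else b) * zeta i 0).
  by rewrite /elliptic_mx -scalemxAl mul_diag_mx !mxE.
rewrite big_ord_recl !cE /= mulr1.
under eq_bigr => i _ do rewrite cE /= mulr0 add0r mulrA exprMn.
rewrite -mulr_sumr zE /radial_step sqrtr_sqr ger0_norm ?enorm_ge0//.
by ring.
Qed.

End geometry.

Lemma sphere_coordinate_le1 {R : realType} (d : nat) (u : 'cV[R]_d.+1) i :
  enorm u = 1 -> `|u i 0| <= 1.
Proof.
move=> u1; rewrite -(@ler_pXn2r _ 2)// ?nnegrE// expr1n real_normK ?num_real//.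
have -> : 1 = enorm u ^+ 2 by rewrite u1 expr1n.
by rewrite sqr_enorm (bigD1 i)//= lerDl; apply: sumr_ge0 => *; exact: sqr_ge0.
Qed.

(** Open intervals generate the Borel sets of the line, and continuity pulls them back to open
    sets. *)
Lemma measurable_coord {R : realType} (m n : nat) (i : 'I_m) (j : 'I_n) :
  measurable_fun setT (fun x : borel_mx R m n => (x : 'M[R]_(m, n)) i j).
Proof.
apply: (measurability _ (RGenOpens.measurableE R)) => _ [_ [x [y ->]] <-].
rewrite setTI; apply: sub_sigma_algebra.
apply: open_comp => [M _|]; first exact: coord_continuous.
exact: interval_open.
Qed.

(* The coordinates of a uniform vector are bounded by 1 only almost surely;
   clipping makes the bound hold everywhere. *)
Definition clip {R : realType} (x : R) : R := Num.max (-1) (Num.min 1 x).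

Lemma clip_norm {R : realType} (x : R) : `|clip x| <= 1.
Proof.
rewrite /clip ler_norml; apply/andP; split; first by rewrite le_max lexx.
by rewrite ge_max ge_min lexx /= andbT; lra.
Qed.

Lemma clip_id {R : realType} (x : R) : `|x| <= 1 -> clip x = x.
Proof.
by rewrite ler_norml => /andP[x1 x2]; rewrite /clip (min_idPr x2) (max_idPr x1).
Qed.

Lemma clipN {R : realType} (x : R) : clip (- x) = - clip x.
Proof.
rewrite /clip; case: (leP 1 (- x)) => ?; case: (leP 1 x) => ?; try lra.
all: by case: leP => ?; case: leP => ?; lra.
Qed.

Lemma measurable_clip {R : realType} : measurable_fun setT (@clip R).
Proof. by apply: measurable_maxr => //; apply: measurable_minr. Qed.

Section sphere.
Context {disp : measure_display} {T : measurableType disp} {R : realType}.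
Variables (P : probability T R).

Lemma ge0_integral_eq_law (X Y : T -> R) (h : R -> \bar R) :
  measurable_fun setT X -> measurable_fun setT Y -> measurable_fun setT h ->
  (forall x, (0 <= h x)%E) ->
  (forall B, measurable B -> P (X @^-1` B) = P (Y @^-1` B)) ->
  (\int[P]_w h (X w) = \int[P]_w h (Y w))%E.
Proof.
move=> mX mY mh h0 XY.
transitivity (\int[pushforward P X]_x h x)%E.
  by rewrite (ge0_integral_pushforward mX).
transitivity (\int[pushforward P Y]_x h x)%E; last first.
  by rewrite (ge0_integral_pushforward mY).
pose X' : {mfun T >-> R} := HB.pack X (isMeasurableFun.Build _ _ _ _ _ mX).
pose Y' : {mfun T >-> R} := HB.pack Y (isMeasurableFun.Build _ _ _ _ _ mY).
change (\int[distribution P X']_x h x = \int[distribution P Y']_x h x)%E.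
by apply: eq_measure_integral => A mA _; exact: XY.
Qed.

Variables (d : nat) (zeta : T -> 'cV[R]_d.+1).
Hypothesis hzeta : uniform_on_sphere P zeta.

Lemma measurable_coordinate i : measurable_fun setT (fun w => zeta w i 0).
Proof.
have [mz _ _] := hzeta.
exact: (measurableT_comp (measurable_coord i 0) mz).
Qed.

Lemma measurable_clip_coordinate i :
  measurable_fun setT (fun w => clip (zeta w i 0)).
Proof. exact: (measurableT_comp measurable_clip (measurable_coordinate i)). Qed.

Lemma uniform_ae_sphere : {ae P, forall w, enorm (zeta w) = 1}.
Proof.
have [_ sph _] := hzeta.
have mn : measurable_fun setT (fun w => enorm (zeta w)).
  apply: measurableT_comp; first exact: measurable_sqrt.
  apply: measurable_sum => i; apply: measurable_funX.
  exact: measurable_coordinate.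
have mS : measurable (zeta @^-1` @usphere R d.+1).
  have := mn measurableT _ (measurable_set1 1); rewrite setTI.
  by congr measurable; apply/seteqP; split.
exists (~` (zeta @^-1` @usphere R d.+1)); split => //.
- exact: measurableC.
- by rewrite probability_setC// sph subee.
Qed.

Lemma uniform_coordinate_law (U : 'M[R]_d.+1) i (B : set R) :
  orthogonal_mx U -> measurable B ->
  P ((fun w => (U *m zeta w) i 0) @^-1` B) = P ((fun w => zeta w i 0) @^-1` B).
Proof.
move=> oU mB; have [_ _ inv] := hzeta.
pose g (x : borel_mx R d.+1 1) : R := (x : 'cV[R]_d.+1) i 0.
have mg : measurable_fun setT g by exact: measurable_coord.
have mB' : measurable (g @^-1` B) by have := mg measurableT B mB; rewrite setTI.
exact: inv U _ oU mB'.
Qed.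

(** Invariance under [- 1%:M] makes each coordinate symmetric. Laws are compared on nonnegative
    integrands, hence the added 1; a finite mean [r] then satisfies [1 - r = 1 + r]. *)
Lemma uniform_mean i : (\int[P]_w (clip (zeta w i 0))%:E = 0)%E.
Proof.
have mc := measurable_clip_coordinate i.
have ic : P.-integrable setT (EFin \o fun w => clip (zeta w i 0)).
  by apply: (bounded_integrable _ (K := 1)) => // w; exact: clip_norm.
have i1 : P.-integrable setT (EFin \o cst (1 : R)).
  by apply: (bounded_integrable _ (K := 1)) => // w; rewrite normr1.
have o : orthogonal_mx (- 1%:M : 'M[R]_d.+1).
  rewrite /orthogonal_mx [X in X *m _](linearN (@trmx _ _ _)).
  by rewrite mulNmx mulmxN opprK mulmx1; exact: trmx1.
have E : (\int[P]_w (1 + clip (- zeta w i 0))%:E =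
          \int[P]_w (1 + clip (zeta w i 0))%:E)%E.
  apply: (ge0_integral_eq_law (X := fun w => - zeta w i 0)
     (h := fun x => (1 + clip x)%:E)).
  - by apply: measurableT_comp => //; exact: measurable_coordinate.
  - exact: measurable_coordinate.
  - apply/measurable_EFinP; apply: measurable_funD => //.
    exact: measurable_clip.
  - by move=> x; rewrite lee_fin; have := clip_norm x; rewrite ler_norml; lra.
  - move=> B mB; rewrite -(uniform_coordinate_law i o mB); congr (P _).
    by apply/seteqP; split => w /=; rewrite mulNmx mul1mx !mxE.
have fc := integrable_fin_num measurableT ic.
move: E; under eq_integral do rewrite clipN EFinB.
under [in RHS]eq_integral do rewrite EFinD.
rewrite integralB_EFin// integralD//= integral_probability_cst.
move: fc; case: (\int[P]_w (clip (zeta w i 0))%:E)%E => // r _.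
by rewrite -EFinB -EFinD => -[] h; congr EFin; lra.
Qed.

(** Transpositions of coordinates are orthogonal, so all second moments agree; they sum to 1 because
    the vector lies almost surely on the sphere. *)
Lemma uniform_variance i :
  (\int[P]_w (clip (zeta w i 0) ^+ 2)%:E = (d.+1%:R^-1)%:E)%E.
Proof.
pose I i := (\int[P]_w (clip (zeta w i 0) ^+ 2)%:E)%E.
have mc2 j : measurable_fun setT (fun w => (clip (zeta w j 0) ^+ 2)%:E).
  apply/measurable_EFinP; apply: measurable_funX.
  exact: measurable_clip_coordinate.
have EI j : I j = I i.
  pose U : 'M[R]_d.+1 := perm_mx (tperm i j).
  have o : orthogonal_mx U.
    by rewrite /orthogonal_mx /U tr_perm_mx -perm_mxM mulVg perm_mx1.
  apply: (ge0_integral_eq_law (X := fun w => zeta w j 0)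
     (Y := fun w => zeta w i 0)
     (h := fun x => (clip x ^+ 2)%:E)).
  - exact: measurable_coordinate.
  - exact: measurable_coordinate.
  - by apply/measurable_EFinP; apply: measurable_funX; exact: measurable_clip.
  - by move=> x; rewrite lee_fin sqr_ge0.
  - move=> B mB; rewrite -(uniform_coordinate_law i o mB); congr (P _).
    by apply/seteqP; split => w /=; rewrite /U -row_permE mxE tpermL.
have sumI : (\sum_(j < d.+1) I j = 1%:E)%E.
  rewrite /I -(ge0_integral_sum _ measurableT mc2); last first.
    by move=> j w _; rewrite lee_fin sqr_ge0.
  rewrite -[RHS](integral_probability_cst P).
  apply: ge0_ae_eq_integral => //.
  - exact: emeasurable_sum.
  - by move=> w _; apply: sume_ge0 => j _; rewrite lee_fin sqr_ge0.
  apply: filterS uniform_ae_sphere => w sph _.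
  have s1 : \sum_(j < d.+1) zeta w j 0 ^+ 2 = 1.
    by rewrite -sqr_enorm sph expr1n.
  rewrite sumEFin -[in RHS]s1; congr EFin; apply: eq_bigr => j _.
  by rewrite clip_id// sphere_coordinate_le1.
have : I i \is a fin_num.
  rewrite /I; apply: integrable_fin_num => //.
  apply: (bounded_integrable _ (K := 1)).
    by apply: measurable_funX; exact: measurable_clip_coordinate.
  by move=> w; rewrite normrX exprn_ile1// clip_norm.
rewrite -/(I i); move: sumI; under eq_bigr do rewrite EI.
case: (I i) => // r; rewrite sumEFin sumr_const card_ord => -[] h _; congr EFin.
apply: (mulIf (x := d.+1%:R)); first by rewrite pnatr_eq0.
by rewrite mulVf ?pnatr_eq0// mulr_natr.
Qed.

End sphere.

Section independence.
Context {disp : measure_display} {T : measurableType disp} {R : realType}.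

Lemma mutually_independent_coordinates (P : probability T R) (d : nat)
    (zeta : nat -> T -> 'cV[R]_d) (g : 'cV[R]_d -> R) :
  measurable_fun setT (g : borel_mx R d 1 -> R) ->
  mutually_independent P zeta ->
  forall n (B : nat -> set R), (forall k, measurable (B k)) ->
  P (\bigcap_(k in `I_n) ((g \o zeta k) @^-1` B k)) =
  (\prod_(k < n) P ((g \o zeta k) @^-1` B k))%E.
Proof.
move=> mg ind n B mB.
pose J := [fset k in iota 0 n]%fset.
have JE k : (k \in J) = (k < n)%N by rewrite inE /= mem_iota add0n.
have mgB k : measurable ((g : borel_mx R d 1 -> R) @^-1` B k).
  by have := mg measurableT (B k) (mB k); rewrite setTI.
have := ind J (fun k => g @^-1` B k) mgB.
have -> : [set` J] = `I_n by apply/seteqP; split => k /=; rewrite JE.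
move=> ->; rewrite -(big_mkord xpredT (fun k => P ((g \o zeta k) @^-1` B k))).
rewrite /index_iota subn0; apply: perm_big; apply: uniq_perm.
- exact: fset_uniq.
- exact: iota_uniq.
- by move=> k; rewrite JE mem_iota add0n.
Qed.

End independence.

(** * Occupation frequencies *)

(* [f] need not be measurable: null is stated for every bounded set [A], and
   the integral of a nonnegative function is a supremum over simple
   functions. *)
Lemma ge0_le_integral_nonmeasurable {disp : measure_display}
    {T : measurableType disp} {R : realType}
    (mu : {measure set T -> \bar R}) (f g : T -> \bar R) :
  (forall w, 0 <= f w)%E -> (forall w, f w <= g w)%E ->
  (\int[mu]_w f w <= \int[mu]_w g w)%E.
Proof.
move=> f0 fg; have g0 w : (0 <= g w)%E := le_trans (f0 w) (fg w).
rewrite !ge0_integralE//; apply: le_ereal_sup => _ [h hf <-]; exists h => //.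
by move=> w; apply: le_trans (hf w) _; rewrite !patch_setT.
Qed.

(** If [2 ^ k <= n < 2 ^ k.+1], monotonicity bounds the average at [n] by twice the average at
    [2 ^ k.+1], hence the [e / 2] below. *)
Lemma dyadic_average_cvg0 {R : realType} (c : nat -> R) :
  {homo c : m n / (m <= n)%N >-> m <= n} -> (forall n, 0 <= c n) ->
  (2 ^ j)%:R^-1 * c (2 ^ j)%N @[j --> \oo] --> (0 : R) ->
  n%:R^-1 * c n @[n --> \oo] --> (0 : R).
Proof.
move=> ndc c0 h; apply/cvgrPdist_lt => e e0.
have e2 : 0 < e / 2 by rewrite divr_gt0.
have /cvgrPdist_lt/(_ _ e2)[J _ hJ] := h.
exists (2 ^ J)%N => // n /= Jn; rewrite sub0r normrN ger0_norm; last first.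
  by rewrite mulr_ge0 ?invr_ge0.
have n0 : (0 < n)%N by rewrite (leq_trans _ Jn)// expn_gt0.
have /andP[k1 k2] := trunc_log_bounds (isT : 1 < 2)%N n0.
set k := trunc_log 2 n in k1 k2.
have Jk : (J <= k.+1)%N.
  by rewrite -(leq_exp2l (m := 2))// ltnW// (leq_ltn_trans Jn).
have := hJ k.+1 Jk; rewrite sub0r normrN ger0_norm; last first.
  by rewrite mulr_ge0 ?invr_ge0.
move=> hk.
apply: (@le_lt_trans _ _ ((2 ^ k)%:R^-1 * c (2 ^ k.+1)%N)).
  rewrite ler_pM ?invr_ge0//; last exact: ndc (ltnW k2).
  by rewrite lef_pV2 ?posrE ?ltr0n ?expn_gt0// ler_nat.
move: hk; rewrite {1}expnS natrM invfM -mulrA.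
set t := _ * c _; lra.
Qed.

Section negligible_occupation.
Context {disp : measure_display} {T : measurableType disp} {R : realType}.
Variables (P : probability T R) (I : nat -> T -> bool) (C : R).
Hypothesis mI : forall k, measurable_fun setT (I k).
Hypothesis C0 : 0 <= C.
Hypothesis sumI : forall n,
  (\sum_(0 <= k < n) \int[P]_w ((I k w)%:R)%:E <= (C * Num.sqrt n%:R)%:E)%E.

Let O (n : nat) (w : T) : R := n%:R^-1 * \sum_(0 <= k < n) (I k w)%:R.

Let mIR k : measurable_fun setT (fun w => (I k w)%:R : R).
Proof.
rewrite (_ : (fun _ => _) = (fun w => if I k w then 1 else 0)).
  exact: measurable_fun_ifT.
by apply/funext => w; case: ifP.
Qed.

Lemma measurable_frequency n : measurable_fun setT (O n).
Proof. by apply: measurable_funM => //; apply: measurable_sum. Qed.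

Lemma frequency_ge0 n w : 0 <= O n w.
Proof. by rewrite mulr_ge0 ?invr_ge0// sumr_ge0. Qed.

Lemma integral_frequency n : (\int[P]_w (O n w)%:E <= (C / Num.sqrt n%:R)%:E)%E.
Proof.
(* At [n = 0] both sides are 0, since the inverse of 0 is 0. *)
have [->|n0] := posnP n.
  rewrite sqrtr0 invr0 mulr0 /O.
  under eq_integral do rewrite big_nil mulr0.
  by rewrite integral_probability_cst.
under eq_integral do rewrite EFinM.
rewrite ge0_integralZl_EFin//; last 2 first.
- by move=> w _; rewrite lee_fin sumr_ge0.
- by apply/measurable_EFinP; exact: measurable_sum.
under eq_integral do rewrite -sumEFin.
rewrite ge0_integral_sum//; last by move=> k; apply/measurable_EFinP.
apply: (@le_trans _ _ (n%:R^-1%:E * (C * Num.sqrt n%:R)%:E)%E).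
  by apply: lee_wpmul2l => //; rewrite lee_fin invr_ge0.
rewrite -EFinM lee_fin -{1}(@sqr_sqrtr _ n%:R)//.
have t0 : Num.sqrt (n%:R : R) != 0 by rewrite gt_eqF// sqrtr_gt0 ltr0n.
by rewrite le_eqVlt; apply/orP; left; apply/eqP; field.
Qed.

Lemma frequency_ae_cvg0 : {ae P, forall w, O n w @[n --> \oo] --> (0 : R)}.
Proof.
(* Ratio of the geometric series that bounds the expected frequencies along [2 ^ j]. *)
pose q : R := (Num.sqrt 2)^-1.
have sq1 : 1 < Num.sqrt (2 : R) by rewrite -[X in X < _]sqrtr1 ltr_sqrt// ltr1n.
have sq0 : 0 < Num.sqrt (2 : R) by rewrite (lt_trans ltr01).
have q0 : 0 < q by rewrite invr_gt0.
have q1 : q < 1 by rewrite invf_lt1.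
have sqj j : (Num.sqrt (2 ^ j)%:R)^-1 = q ^+ j.
  rewrite /q exprVn; congr (_^-1).
  rewrite natrX -{1}(@sqr_sqrtr _ 2)// -exprM mulnC exprM sqrtr_sqr.
  by rewrite ger0_norm// exprn_ge0// ltW.
have : {ae P, forall w, O (2 ^ j)%N w @[j --> \oo] --> (0 : R)}.
  apply: (@ae_cvg0_summable _ _ _ _ (fun j => O (2 ^ j)%N) (C / (1 - q))).
  - by move=> j; exact: measurable_frequency.
  - by move=> j w; exact: frequency_ge0.
  - move=> n; apply: (@le_trans _ _ (\sum_(0 <= k < n) (C * q ^+ k)%:E)%E).
      by apply: lee_sum => k _; rewrite -sqj; exact: integral_frequency.
    rewrite sumEFin lee_fin.
    have := @geometric_le_lim R n C q C0 q0.
    by rewrite (gtr0_norm q0) => /(_ q1); rewrite /series.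
apply: filterS => w; apply: dyadic_average_cvg0 => [m n mn|n].
  rewrite (big_cat_nat (n := m) (p := n))//= lerDl sumr_ge0//.
by rewrite sumr_ge0.
Qed.

(** As [0 <= F <= 1] and [1 <= q], the [q]-th power of [F] is at most [F], so the norm is at most
    the [1/q]-th power of the expected frequency. *)
Lemma frequency_Lnorm_cvg0 (F : nat -> T -> R) (q : R) : 1 <= q ->
  (forall n w, 0 <= F n w <= 1) ->
  {ae P, forall w, forall n, F n w <= O n w} ->
  ('N[P]_(q%:E)[EFin \o F n] @[n --> \oo] --> 0)%E.
Proof.
move=> q1 F01 [N [mN PN0 FN]].
have q0 : 0 < q := lt_le_trans ltr01 q1.
(* [F] may be nonmeasurable and is dominated by [O] only off the null set [N]; [H] is a measurable
   majorant everywhere, with the same integral as [O]. *)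
pose H n w := if w \in N then 1 else O n w.
have mH n : measurable_fun setT (H n).
  apply: measurable_fun_ifT => //; last exact: measurable_frequency.
  apply: (measurable_fun_bool true); rewrite setTI.
  rewrite (_ : _ @^-1` _ = N)//.
  by apply/seteqP; split => w; [exact: set_mem|exact: mem_set].
have FH n w : F n w <= H n w.
  rewrite /H; case: ifPn => [_|/negP wN]; first by have /andP[] := F01 n w.
  by apply: contrapT => nF; apply: wN; rewrite inE; apply: FN => /= /(_ n).
have Lle n : ('N[P]_(q%:E)[EFin \o F n] <= ((C / Num.sqrt n%:R) `^ q^-1)%:E)%E.
  rewrite unlock /= -poweR_EFin; apply: gt0_ler_poweR.
  - by rewrite invr_ge0 ltW.
  - rewrite in_itv/= leey andbT.
    by apply: integral_ge0 => w _; rewrite lee_fin powR_ge0.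
  - by rewrite in_itv/= leey andbT lee_fin divr_ge0.
  apply: le_trans (integral_frequency n).
  apply: (@le_trans _ _ (\int[P]_w (H n w)%:E)%E).
    apply: ge0_le_integral_nonmeasurable => w.
      by rewrite lee_fin powR_ge0.
    rewrite lee_fin; apply: le_trans (FH n w).
    have /andP[f0 f1] := F01 n w; rewrite ger0_norm//.
    move: f0; rewrite le_eqVlt => /predU1P[<-|f0].
      by rewrite powR0// gt_eqF.
    by rewrite ge1r_powR// f0.
  have -> // : (\int[P]_w (H n w)%:E = \int[P]_w (O n w)%:E)%E.
  apply: ge0_ae_eq_integral => //.
  - exact/measurable_EFinP.
  - by apply/measurable_EFinP; exact: measurable_frequency.
  - by move=> w _; rewrite lee_fin /H; case: ifP => // _; exact: frequency_ge0.
  - by move=> w _; rewrite lee_fin; exact: frequency_ge0.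
  exists N; split => // w /= h; apply: contrapT => wN; apply: h => _.
  by rewrite /H memNset.
have up : ((C / Num.sqrt n%:R) `^ q^-1)%:E @[n --> \oo] --> 0%E.
  apply: cvg_EFin; first exact: nearW.
  apply/cvgrPdist_le => e e0.
  have eq0 : 0 < e `^ q by rewrite powR_gt0.
  near=> n.
  have n0 : 0 < (n%:R : R).
    by near: n; exists 1%N => // n /= n1; rewrite ltr0n.
  rewrite /= sub0r normrN ger0_norm ?powR_ge0//.
  have -> : e = (e `^ q) `^ q^-1.
    by rewrite -powRrM mulfV ?gt_eqF// powRr1// ltW.
  apply: ge0_ler_powR;
    rewrite ?nnegrE ?invr_ge0 ?divr_ge0 ?powR_ge0 ?(ltW q0)//.
  rewrite ler_pdivrMr ?sqrtr_gt0// -ler_pdivrMl//.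
  rewrite -(@ler_pXn2r _ 2)// ?nnegrE ?sqrtr_ge0//;
    rewrite ?mulr_ge0 ?invr_ge0 ?powR_ge0//.
  rewrite sqr_sqrtr//; near: n; exact: nbhs_infty_ger.
apply: squeeze_cvge (cvg_cst 0%E) up; apply: nearW => n.
by rewrite Lnorm_ge0/=.
Unshelve. all: by end_near. Qed.

End negligible_occupation.

Lemma occupation_itv {R : realType} {disp : measure_display}
    {T : measurableType disp} (d : nat) (X : nat -> T -> 'cV[R]_d) A n w :
  0 <= occupation X A n w <= 1.
Proof.
rewrite /occupation mulr_ge0 ?invr_ge0 ?sumr_ge0//=.
have [->|n0] := posnP n; first by rewrite invr0 mul0r.
rewrite mulrC ler_pdivrMr ?ltr0n// mul1r.
apply: (@le_trans _ _ (\sum_(0 <= k < n) 1)).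
  by apply: ler_sum => k _; rewrite indicE; case: (_ \in _).
by rewrite big_const_nat subn0 iter_addr_0.
Qed.

(** * The elliptic random walk *)

Theorem corollary3p2 (R : realType) (disp : measure_display)
    (T : measurableType disp) (P : probability T R)
    (d : nat) (hd : (2 <= d)%N) (a b : R) (ha : 0 < a) (hb : 0 < b)
    (X : nat -> T -> 'cV[R]_d) (hX : elliptic_random_walk P a b X) :
  (a ^+ 2 < (d%:R - 1) * b ^+ 2 -> transient P X) /\
  ((d%:R - 1) * b ^+ 2 <= a ^+ 2 -> null_recurrent P X).
Proof.
case: d hd X hX => [//|d] hd X [Q [zeta [x0 [[Qo Qe _] unif ind X0 step]]]].
pose z n w := clip (zeta n w 0 0).
pose v : R := d.+1%:R^-1; pose q : R := Num.sqrt d.+1%:R.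
pose S := driven_chain z (fun=> radial_step (q * a) (q * b)) (enorm x0 ^+ 2).
have d0 : 0 < d.+1%:R :> R by rewrite ltr0n.
have q0 : 0 < q by rewrite sqrtr_gt0.
have al0 : 0 < q * a by rewrite mulr_gt0.
have be0 : 0 < q * b by rewrite mulr_gt0.
have v0 : 0 < v by rewrite invr_gt0.
(* Dimension at least 2 enters here; [v < 1] leaves a transversal part to the motion. *)
have v1 : v < 1 by rewrite invf_lt1// ltr1n.
have qv : q ^+ 2 * v = 1 by rewrite sqr_sqrtr ?ltW// divff// gt_eqF.
have qE : q ^+ 2 = d.+1%:R by rewrite sqr_sqrtr// ltW.
(* These two identities turn the drift conditions into the comparison of [a ^+ 2] with
   [(d - 1) * b ^+ 2], [d] being the dimension. *)
have alv : (q * a) ^+ 2 * v = a ^+ 2 by rewrite exprMn mulrAC qv mul1r.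
have bev : (q * b) ^+ 2 * (1 - v) = (d.+1%:R - 1) * b ^+ 2.
  by rewrite exprMn mulrAC mulrBr mulr1 qv qE.
have s00 : 0 <= enorm x0 ^+ 2 by exact: sqr_ge0.
have mz n : measurable_fun setT (z n) by exact: measurable_clip_coordinate.
have z1 n w : `|z n w| <= 1 by exact: clip_norm.
have z_mean n : (\int[P]_w (z n w)%:E = 0)%E by exact: uniform_mean.
have z_var n : (\int[P]_w (z n w ^+ 2)%:E = v%:E)%E by exact: uniform_variance.
have indz := mutually_independent_coordinates
  (measurableT_comp measurable_clip (measurable_coord 0 0)) ind.
(* Off countably many null sets every [zeta n] lies on the sphere, where clipping does nothing. *)
have SE : {ae P, forall w, forall n, enorm (X n w) ^+ 2 = S n w}.
  have := ae_foralln (fun n => uniform_ae_sphere (unif n)).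
  apply: filterS => w sph; elim=> [|n ih]; first by rewrite X0.
  have hs := enorm_hat (X n w).
  have -> : X n.+1 w =
      X n w + Q (hat (X n w)) *m elliptic_mx d.+1 a b *m zeta n w.
    by rewrite -step addrC subrK.
  rewrite (sqr_enorm_step _ _ (Qo _ hs) (Qe _ hs) (sph n)) ih /=.
  by rewrite -[zeta n w 0 0]clip_id ?sphere_coordinate_le1.
split=> [tr|rec].
  have := radial_chain_transient mz indz z1 z_mean z_var al0 be0 v0 s00.
  rewrite alv bev => /(_ tr); apply: filterS2 SE => w SE /cvgryPge Sy.
  apply/cvgryPge => M; apply: filterS (Sy (M ^+ 2)) => n MS.
  apply: le_trans (ler_norm M) _.
  rewrite -(@ler_pXn2r _ 2)// ?nnegrE ?enorm_ge0//.
  by rewrite SE real_normK ?num_real.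
split.
  have := radial_chain_recurrent mz indz z1 z_mean z_var al0 be0 v0 s00.
  rewrite alv bev => /(_ rec)[r r0 ret].
  exists (Num.sqrt r); first exact: sqrtr_ge0.
  apply: filterS2 SE (ae_foralln ret) => w SE retw.
  apply: limn_einf_le_frequently => N; have [n Nn Sr] := retw N.
  exists n => //; rewrite lee_fin -(@ger0_norm _ (enorm _)) ?enorm_ge0//.
  by rewrite -sqrtr_sqr ler_wsqrtr// SE.
move=> A [M AM].
have [C C0 occ] := radial_chain_occupation mz indz z1 z_mean z_var
  al0 be0 v0 v1 s00 (M ^+ 2).
pose I k w := S k w <= M ^+ 2.
have mI k : measurable_fun setT (I k).
  by apply: measurable_fun_ler => //; exact: measurable_radial_chain.
(* [A] is an arbitrary bounded set; its visits are dominated by the measurable events that the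
   squared radius is at most [M ^+ 2]. *)
have occO : {ae P, forall w, forall n,
    occupation X A n w <= n%:R^-1 * \sum_(0 <= k < n) (I k w)%:R}.
  apply: filterS SE => w SE n; rewrite ler_wpM2l ?invr_ge0// ler_sum// => k _.
  rewrite indicE; case: (boolP (_ \in _)) => //= /set_mem /AM XM.
  by rewrite /I -SE lerXn2r// ?nnegrE ?enorm_ge0// (le_trans (enorm_ge0 _) XM).
split.
  have := frequency_ae_cvg0 mI C0 occ.
  apply: filterS2 occO => w occw h.
  apply: squeeze_cvgr (cvg_cst 0) h; apply: nearW => n.
  by rewrite occw andbT; have /andP[] := occupation_itv X A n w.
move=> p p1; apply: (frequency_Lnorm_cvg0 mI C0 occ p1) occO => n w.
exact: occupation_itv.
Qed.
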